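(* Let $p$ be a prime with $p\equiv 1\pmod 6$, let $A,B$ be the integers with $4p=A^2+27B^2$, $A\equiv 1\pmod 3$, $B>0$, and put $$n_{12}=\frac{p+A+1}{9},\quad n_{02}=\frac{2p-A+9B-4}{18},\quad n_{01}=\frac{2p-A-9B-4}{18}.$$ Consider the system of equations $$\begin{aligned} c_0+\tfrac1{c_0}&=-\tfrac{p-4}{3}-n_{12}\left(\tfrac{c_2}{c_1}+\tfrac{c_1}{c_2}\right)-n_{02}\left(\tfrac{c_0}{c_2}+\tfrac{c_2}{c_0}\right)-n_{01}\left(\tfrac{c_1}{c_0}+\tfrac{c_0}{c_1}\right),\\ c_1+\tfrac1{c_1}&=-\tfrac{p-4}{3}-n_{12}\left(\tfrac{c_0}{c_2}+\tfrac{c_2}{c_0}\right)-n_{02}\left(\tfrac{c_1}{c_0}+\tfrac{c_0}{c_1}\right)-n_{01}\left(\tfrac{c_2}{c_1}+\tfrac{c_1}{c_2}\right),\\ c_2+\tfrac1{c_2}&=-\tfrac{p-4}{3}-n_{12}\left(\tfrac{c_1}{c_0}+\tfrac{c_0}{c_1}\right)-n_{02}\left(\tfrac{c_2}{c_1}+\tfrac{c_1}{c_2}\right)-n_{01}\left(\tfrac{c_0}{c_2}+\tfrac{c_2}{c_0}\right). \end{aligned}$$ This system has exactly $20$ solutions $(c_0,c_1,c_2)$ in $\mathbb{C}^3$. The first two solutions (the ''$\varepsilon$-solutions'') are $$c_0=c_1=c_2=\frac{2-p\pm\sqrt{p(p-4)}}{2}.$$ The remaining $18$ solutions can be obtained from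 the three solutions $c^{(1)},c^{(2)},c^{(3)}$ listed below by the six transformations $$(c_0,c_1,c_2)\to(c_k,c_{k+1},c_{k+2}),\qquad (c_0,c_1,c_2)\to\left(\frac1{c_k},\frac1{c_{k+1}},\frac1{c_{k+2}}\right),$$ where $k=0,1,2$ and indices are computed modulo $3$. Put $u=\sqrt p$, $v=\sqrt{p+4A+16}$ and $\theta=\frac13\operatorname{Arccos}\left(\frac{A}{2\sqrt p}\right)$. The three solutions are $c^{(i)}=(c^{(i)}_0,c^{(i)}_1,c^{(i)}_2)$, $i=1,2,3$, where $$c^{(i)}_j=\alpha^{(i)}+\beta^{(i)}\cos\left(\theta-\tfrac{2\pi}{3}j\right)+\gamma^{(i)}\sin\left(\theta-\tfrac{2\pi}{3}j\right),\quad j=0,1,2,$$ and $$\begin{aligned} \alpha^{(1)}&=\frac12\,\frac{pA-2p-2A}{p^2-3p-A}+i\,\frac{3\sqrt3}{2}\,\frac{\sqrt p\sqrt{p-4}\,B}{p^2-3p-A},\\ \beta^{(1)}&=-\frac12\,\frac{\sqrt p(p-4)(A+2)}{p^2-3p-A}-i\,\frac{3\sqrt3}{2}\,\frac{\sqrt{p-4}\,(p-2)B}{p^2-3p-A},\\ \gamma^{(1)}&=-\frac{3\sqrt3}{2}\,\frac{\sqrt p(p-4)B}{p^2-3p-A}+\frac i2\,\frac{\sqrt{p-4}\,(pA-2p-2A)}{p^2-3p-A}, \end{aligned}$$ $$\begin{aligned} \alpha^{(2)}&=-\frac12\,\frac{u^2-uv-4}{u^2+uv+2}+\frac i2\,\frac{u\sqrt{4+u-v}\sqrt{4-u+v}}{u^2+uv+2},\\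 \beta^{(2)}&=\frac{(A+2)u}{u^2+uv+2}+\frac i4\,\frac{(u^2+uv+4)\sqrt{4+u-v}\sqrt{4-u+v}}{u^2+uv+2},\\ \gamma^{(2)}&=\frac{3\sqrt3\,Bu}{u^2+uv+2}+\frac i4\,\frac{(u^2-uv-4)\sqrt{u+v+4}\sqrt{u+v-4}}{u^2+uv+2}, \end{aligned}$$ $$\begin{aligned} \alpha^{(3)}&=-\frac12\,\frac{u^2+uv-4}{u^2-uv+2}-\frac u2\,\frac{\sqrt{u+v+4}\sqrt{u+v-4}}{u^2-uv+2},\\ \beta^{(3)}&=\frac{(A+2)u}{u^2-uv+2}-\frac14\,\frac{(u^2-uv+4)\sqrt{u+v+4}\sqrt{u+v-4}}{u^2-uv+2},\\ \gamma^{(3)}&=\frac{3\sqrt3\,Bu}{u^2-uv+2}+\frac14\,\frac{(u^2+uv-4)\sqrt{4+u-v}\sqrt{4-u+v}}{u^2-uv+2}. \end{aligned}$$ The solutions $c^{(1)}$ and $c^{(2)}$ are unimodular (all components have modulus $1$), while the $\varepsilon$-solutions and $c^{(3)}$ are real. Hence of the $20$ solutions $12$ are unimodular and $8$ are real.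
   Context: By a theorem of Gauss, for every prime $p\equiv1\pmod 6$ the integers $A,B$ with $4p=A^2+27B^2$, $A\equiv1\pmod3$, $B>0$ exist and are unique. A solution of the system means a triple of nonzero complex numbers satisfying the equations. $\operatorname{Arccos}$ takes values in $[0,\pi]$. All square roots of positive reals are positive; since $|A|<2\sqrt p$ one has $|u-4|<v<u+4$, so all square roots in the formulas are of positive numbers, and all denominators are nonzero. *)

(* Defs.v *)
From HB Require Import structures.
From mathcomp Require Import all_boot all_order all_algebra.
From mathcomp Require Import complex.
From mathcomp Require Import boolp classical_sets functions cardinality.
From mathcomp Require Import reals trigo.

Set Implicit Arguments.
Unset Strict Implicit.
Unset Printing Implicit Defensive.

Import Order.TTheory GRing.Theory Num.Theory.

Local Open Scope classical_set_scope.
Local Open Scope ring_scope.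
Local Open Scope complex_scope.

(* A triple (c_0, c_1, c_2) of complex numbers. The ring structure of 'I_3 is
   that of Z/3, so that k + j : 'I_3 is an index computed modulo 3. *)
Notation triple R := {ffun 'I_3 -> R[i]}.

Section Triples.
Context {R : realType}.
Implicit Types (c : triple R) (k : 'I_3).

Definition shift c k : triple R := [ffun j => c (k + j)].

Definition shiftV c k : triple R := [ffun j => (c (k + j))^-1].

Definition transforms c : set (triple R) := range (shift c) `|` range (shiftV c).

Definition unimodular : set (triple R) := [set c : triple R | forall j, `|c j| = 1].

(* In R[i], Num.real is the set of numbers with zero imaginary part. *)
Definition real_triple : set (triple R) :=
  [set c : triple R | forall j, c j \is Num.real].

End Triples.

Section System.
Context {R : realType}.
(* The images in R of a prime p = 1 mod 6 and of the integers A, B with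
   4 p = A^2 + 27 B^2. Then |A| < 2 sqrt p, so that below Num.sqrt (which is 0
   on negative numbers) is only applied to positive numbers, no denominator is
   0, and the argument of acos (with values in [0, pi]) lies in ]-1, 1[. *)
Variables p A B : R.

Definition n12 : R := (p + A + 1) / 9.
Definition n02 : R := (2 * p - A + 9 * B - 4) / 18.
Definition n01 : R := (2 * p - A - 9 * B - 4) / 18.

Definition system (c0 c1 c2 : R[i]) : Prop :=
  [/\ c0 + 1 / c0 = - ((p - 4) / 3)%:C
                    - n12%:C * (c2 / c1 + c1 / c2)
                    - n02%:C * (c0 / c2 + c2 / c0)
                    - n01%:C * (c1 / c0 + c0 / c1),
      c1 + 1 / c1 = - ((p - 4) / 3)%:C
                    - n12%:C * (c0 / c2 + c2 / c0)
                    - n02%:C * (c1 / c0 + c0 / c1)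
                    - n01%:C * (c2 / c1 + c1 / c2)
    & c2 + 1 / c2 = - ((p - 4) / 3)%:C
                    - n12%:C * (c1 / c0 + c0 / c1)
                    - n02%:C * (c2 / c1 + c1 / c2)
                    - n01%:C * (c0 / c2 + c2 / c0)].

Definition solutions : set (triple R) :=
  [set c : triple R | (forall j, c j != 0) /\ system (c 0) (c 1) (c 2)].

Definition eps_plus : triple R :=
  [ffun=> ((2 - p + Num.sqrt (p * (p - 4))) / 2)%:C].

Definition eps_minus : triple R :=
  [ffun=> ((2 - p - Num.sqrt (p * (p - 4))) / 2)%:C].

Definition u : R := Num.sqrt p.
Definition v : R := Num.sqrt (p + 4 * A + 16).
Definition theta : R := 1 / 3 * acos (A / (2 * Num.sqrt p)).

Definition trig_triple (alpha beta gamma : R[i]) : triple R :=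
  [ffun j : 'I_3 => alpha + beta * (cos (theta - 2 * pi / 3 * j%:R))%:C
                          + gamma * (sin (theta - 2 * pi / 3 * j%:R))%:C].

Definition alpha1 : R[i] :=
  (1 / 2 * ((p * A - 2 * p - 2 * A) / (p ^+ 2 - 3 * p - A)))
  +i* (3 * Num.sqrt 3 / 2
       * (Num.sqrt p * Num.sqrt (p - 4) * B / (p ^+ 2 - 3 * p - A))).

Definition beta1 : R[i] :=
  (- (1 / 2) * (Num.sqrt p * (p - 4) * (A + 2) / (p ^+ 2 - 3 * p - A)))
  +i* (- (3 * Num.sqrt 3 / 2)
       * (Num.sqrt (p - 4) * (p - 2) * B / (p ^+ 2 - 3 * p - A))).

Definition gamma1 : R[i] :=
  (- (3 * Num.sqrt 3 / 2)
   * (Num.sqrt p * (p - 4) * B / (p ^+ 2 - 3 * p - A)))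
  +i* (1 / 2
       * (Num.sqrt (p - 4) * (p * A - 2 * p - 2 * A) / (p ^+ 2 - 3 * p - A))).

Definition alpha2 : R[i] :=
  (- (1 / 2) * ((u ^+ 2 - u * v - 4) / (u ^+ 2 + u * v + 2)))
  +i* (1 / 2 * (u * Num.sqrt (4 + u - v) * Num.sqrt (4 - u + v)
                / (u ^+ 2 + u * v + 2))).

Definition beta2 : R[i] :=
  ((A + 2) * u / (u ^+ 2 + u * v + 2))
  +i* (1 / 4 * ((u ^+ 2 + u * v + 4)
                * Num.sqrt (4 + u - v) * Num.sqrt (4 - u + v)
                / (u ^+ 2 + u * v + 2))).

Definition gamma2 : R[i] :=
  (3 * Num.sqrt 3 * B * u / (u ^+ 2 + u * v + 2))
  +i* (1 / 4 * ((u ^+ 2 - u * v - 4)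
                * Num.sqrt (u + v + 4) * Num.sqrt (u + v - 4)
                / (u ^+ 2 + u * v + 2))).

Definition alpha3 : R :=
  - (1 / 2) * ((u ^+ 2 + u * v - 4) / (u ^+ 2 - u * v + 2))
  - u / 2 * (Num.sqrt (u + v + 4) * Num.sqrt (u + v - 4)
             / (u ^+ 2 - u * v + 2)).

Definition beta3 : R :=
  (A + 2) * u / (u ^+ 2 - u * v + 2)
  - 1 / 4 * ((u ^+ 2 - u * v + 4)
             * Num.sqrt (u + v + 4) * Num.sqrt (u + v - 4)
             / (u ^+ 2 - u * v + 2)).

Definition gamma3 : R :=
  3 * Num.sqrt 3 * B * u / (u ^+ 2 - u * v + 2)
  + 1 / 4 * ((u ^+ 2 + u * v - 4)
             * Num.sqrt (4 + u - v) * Num.sqrt (4 - u + v)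
             / (u ^+ 2 - u * v + 2)).

Definition sol1 : triple R := trig_triple alpha1 beta1 gamma1.
Definition sol2 : triple R := trig_triple alpha2 beta2 gamma2.
Definition sol3 : triple R := trig_triple alpha3%:C beta3%:C gamma3%:C.

End System.

(* Main.v *)
Require Import Defs.
From mathcomp Require Import all_boot all_order all_algebra.
From mathcomp Require Import complex finmap.
From mathcomp Require Import boolp classical_sets functions cardinality.
From mathcomp Require Import reals trigo.
From mathcomp Require Import ring lra zify.

(* Take the Fourier transform over Z/3 of c and of 1/c:
     c_j = a + b w^j + d w^(-j),   1/c_j = a' + b' w^j + d' w^(-j),
   where w = exp(2 i pi / 3). With pi = (A + 3 sqrt 3 B i) / 2, of norm p, the
   system together with c_j (1/c_j) = 1 becomes
     a + a' + (p - 1) a a' = 1,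
     b + b' + (1 + pi) d d' = 0,     d + d' + (1 + pi^-) b b' = 0,
     a a' + b d' + d b' = 1,  a b' + b a' + d d' = 0,  a d' + d a' + b b' = 0.
   For given a and a', the equations containing b + b' and a b' + b a' are
   linear in b and b', and have determinant a' - a, which never vanishes because
   pi is not real. Hence b, b' are multiples of d d', and likewise d, d' of b b'.
   Either all four vanish, which gives the epsilon-solutions, or (d d')^3 is a
   function of a and a', and mu = a a' is a root of
     ((p^2 - 3p - A) mu - (p - A)) ((1 - 3p - Ap) mu^2 - (p + 2) mu + 1) = 0.
   A root mu determines {a, a'}, and the choice of a cube root amounts to a cyclic
   shift: so each of the three roots gives one orbit of the six transformations.
   The explicit triples realize the three roots. As a <> a', no solution equals
   its inverse, hence none is both real and unimodular. *)

Set Implicit Arguments.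
Unset Strict Implicit.
Unset Printing Implicit Defensive.

Import Order.TTheory GRing.Theory Num.Theory.

Local Open Scope classical_set_scope.
Local Open Scope card_scope.
Local Open Scope ring_scope.

(** * Equations as linear combinations of given equations *)

Section LinearCombination.
Variable F : pzRingType.
Implicit Types x y k : F.

Lemma eqrD x1 y1 x2 y2 : x1 = y1 -> x2 = y2 -> x1 + x2 = y1 + y2.
Proof. by move=> -> ->. Qed.

Lemma eqrZ k x y : x = y -> k * x = k * y.
Proof. by move->. Qed.

(** Once a linear combination of known equations, built with [eqrD] and [eqrZ], is supplied as x1 =
    y1, only a polynomial identity remains. *)
Lemma eqr_by x1 y1 x y : x1 = y1 -> x - y = x1 - y1 -> x = y.
Proof. by move=> ->; rewrite subrr; exact: subr0_eq. Qed.

End LinearCombination.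

(** * The system in Fourier coordinates *)

(* The equations of the header, with [m = 1 + pi] and [mb] its conjugate. *)
Record fourier_system (F : fieldType) (p m mb a b d a' b' d' : F) : Prop :=
  FourierSystem {
    fs_mean : a + a' + (p - 1) * (a * a') = 1;
    fs_freq1 : b + b' + m * (d * d') = 0;
    fs_freq2 : d + d' + mb * (b * b') = 0;
    fs_inv0 : a * a' + b * d' + d * b' = 1;
    fs_inv1 : a * b' + b * a' + d * d' = 0;
    fs_inv2 : a * d' + d * a' + b * b' = 0 }.

Section Fourier.
Variable F : fieldType.
Variables w p m mb : F.
Hypothesis w_def : w ^+ 2 = - 1 - w.
Hypothesis three_neq0 : 3 != 0 :> F.

(* [x_j] stands for [c_j] and [y_j] for its inverse. *)
Definition class_eq n1 n2 n3 (x0 x1 x2 y0 y1 y2 : F) :=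
  x0 + y0 = - ((p - 4) / 3) - n1 * (x2 * y1 + x1 * y2)
            - n2 * (x0 * y2 + x2 * y0) - n3 * (x1 * y0 + x0 * y1).

(** Up to a factor 1/3, the inverse Fourier transform of (p - 1, m, mb); for m = 1 + pi these are
    [n12], [n02], [n01]. *)
Let n1 := (p - 1 + m + mb) / 9.
Let n2 := (p - 1 + w ^+ 2 * m + w * mb) / 9.
Let n3 := (p - 1 + w * m + w ^+ 2 * mb) / 9.

(** The Fourier transform turns the sums of products c_j c_k' with j <> k into products of Fourier
    coefficients, after the diagonal terms c_j c_j' = 1 are added. The last three equations are the
    transform of c_j c_j' = 1 itself. *)
Lemma class_eq_fourier c0 c1 c2 c0' c1' c2' :
  c0 * c0' = 1 -> c1 * c1' = 1 -> c2 * c2' = 1 ->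
  class_eq n1 n2 n3 c0 c1 c2 c0' c1' c2' ->
  class_eq n1 n2 n3 c1 c2 c0 c1' c2' c0' ->
  class_eq n1 n2 n3 c2 c0 c1 c2' c0' c1' ->
  fourier_system p m mb
    ((c0 + c1 + c2) / 3) ((c0 + w ^+ 2 * c1 + w * c2) / 3) ((c0 + w * c1 + w ^+ 2 * c2) / 3)
    ((c0' + c1' + c2') / 3) ((c0' + w ^+ 2 * c1' + w * c2') / 3) ((c0' + w * c1' + w ^+ 2 * c2') / 3).
Proof.
rewrite /class_eq /n1 /n2 /n3 => h0 h1 h2 e0 e1 e2.
have nine_neq0 : 9 != 0 :> F by rewrite (_ : 9 = 3 * 3 :> F) ?mulf_neq0//; ring.
split.
- apply: (eqr_by (eqrZ (1/3) (eqrD e0 (eqrD e1 e2)))).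
  by field: w_def h0 h1 h2; do ?[apply/andP; split].
- apply: (eqr_by (eqrZ (1/3) (eqrD e0 (eqrD (eqrZ (w^+2) e1) (eqrZ w e2))))).
  by field: w_def h0 h1 h2; do ?[apply/andP; split].
- apply: (eqr_by (eqrZ (1/3) (eqrD e0 (eqrD (eqrZ w e1) (eqrZ (w^+2) e2))))).
  by field: w_def h0 h1 h2; do ?[apply/andP; split].
- by field: w_def h0 h1 h2; do ?[apply/andP; split].
- by field: w_def h0 h1 h2; do ?[apply/andP; split].
- by field: w_def h0 h1 h2; do ?[apply/andP; split].
Qed.

Section FourierToClass.
Variables a b d a' b' d' : F.
Hypothesis fs : fourier_system p m mb a b d a' b' d'.
Let c0 := a + b + d.
Let c1 := a + b * w + d * w ^+ 2.
Let c2 := a + b * w ^+ 2 + d * w.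
Let c0' := a' + b' + d'.
Let c1' := a' + b' * w + d' * w ^+ 2.
Let c2' := a' + b' * w ^+ 2 + d' * w.

Lemma fourier_inv : [/\ c0 * c0' = 1, c1 * c1' = 1 & c2 * c2' = 1].
Proof.
case: fs => _ _ _ e0 e1 e2; rewrite /c0 /c1 /c2 /c0' /c1' /c2'; split.
- by apply: (eqr_by (eqrD e0 (eqrD e1 e2))); ring: w_def.
- by apply: (eqr_by (eqrD e0 (eqrD (eqrZ w e1) (eqrZ (w ^+ 2) e2)))); ring: w_def.
- by apply: (eqr_by (eqrD e0 (eqrD (eqrZ (w ^+ 2) e1) (eqrZ w e2)))); ring: w_def.
Qed.

Lemma fourier_class_eq :
  [/\ class_eq n1 n2 n3 c0 c1 c2 c0' c1' c2',
      class_eq n1 n2 n3 c1 c2 c0 c1' c2' c0' &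
      class_eq n1 n2 n3 c2 c0 c1 c2' c0' c1'].
Proof.
have nine_neq0 : 9 != 0 :> F by rewrite (_ : 9 = 3 * 3 :> F) ?mulf_neq0//; ring.
rewrite /class_eq /n1 /n2 /n3 /c0 /c1 /c2 /c0' /c1' /c2'.
case: fs => f0 f1 f2 e0 e1 e2.
(* The products a a', d d', b b' contain diagonal terms c_j c_j', absent from the class equations.
   The multiples of [e0], [e1], [e2] cancel them, and the constant 1 becomes - (p - 4) / 3. *)
have h0 := eqrD f0 (eqrZ (- ((p - 1) / 3)) e0).
have h1 := eqrD f1 (eqrZ (- (m / 3)) e1).
have h2 := eqrD f2 (eqrZ (- (mb / 3)) e2).
split.
- by apply: (eqr_by (eqrD h0 (eqrD h1 h2))); field: w_def; do ?[apply/andP; split].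
- by apply: (eqr_by (eqrD h0 (eqrD (eqrZ w h1) (eqrZ (w ^+ 2) h2)))); field: w_def; do ?[apply/andP; split].
- by apply: (eqr_by (eqrD h0 (eqrD (eqrZ (w ^+ 2) h1) (eqrZ w h2)))); field: w_def; do ?[apply/andP; split].
Qed.
End FourierToClass.
End Fourier.

Lemma fourier_systemC (F : fieldType) (p m mb a b d a' b' d' : F) :
  fourier_system p m mb a b d a' b' d' -> fourier_system p m mb a' b' d' a b d.
Proof.
case=> f0 f1 f2 e0 e1 e2; split.
- by apply: (eqr_by f0); ring.
- by apply: (eqr_by f1); ring.
- by apply: (eqr_by f2); ring.
- by apply: (eqr_by e0); ring.
- by apply: (eqr_by e1); ring.
- by apply: (eqr_by e2); ring.
Qed.

(** Exchanging the two frequencies exchanges m and mb, so that facts on b, b' transfer to d, d'. *)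
Lemma fourier_system_conj (F : fieldType) (p m mb a b d a' b' d' : F) :
  fourier_system p m mb a b d a' b' d' -> fourier_system p mb m a d b a' d' b'.
Proof.
case=> f0 f1 f2 e0 e1 e2; split => //.
by apply: (eqr_by e0); ring.
Qed.

(** * Cramer's rule for the first frequency *)

Section FourierFreq.
Variables (F : fieldType) (p m mb : F).
Variables a b d a' b' d' : F.
Hypothesis fs : fourier_system p m mb a b d a' b' d'.

Lemma freq1_mean : b * (a' - a) = d * d' * (a * m - 1).
Proof.
case: fs => _ f1 _ _ e1 _.
by apply: (eqr_by (eqrD e1 (eqrZ (- a) f1))); ring.
Qed.

Lemma freq1_mean' : b' * (a' - a) = - (d * d' * (a' * m - 1)).
Proof.
case: fs => _ f1 _ _ e1 _.
by apply: (eqr_by (eqrD (eqrZ (- 1) e1) (eqrZ a' f1))); ring.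
Qed.

End FourierFreq.

(** * Elimination of the frequencies and the equation for mu *)

Section FourierSolutions.
Variables (F : fieldType) (p m mb : F).
Hypothesis p_def : p = (m - 1) * (mb - 1).
Hypothesis p_neq0 : p != 0.
Hypothesis p_neq4 : p != 4.
Hypothesis m_neq : m != mb.

Section One.
Variables a b d a' b' d' : F.
Hypothesis fs : fourier_system p m mb a b d a' b' d'.

(** The factors in Cramer's formulas: X, X' for b, b' and Y, Y' for d, d'. *)
Let X := a * m - 1.
Let X' := a' * m - 1.
Let Y := a * mb - 1.
Let Y' := a' * mb - 1.

Lemma fs_freq_zero : d * d' = 0 -> b * b' = 0 -> a != a' ->
  [/\ b = 0, b' = 0, d = 0 & d' = 0].
Proof.
move=> dd0 bb0 aa; have aa' : a' - a != 0 by rewrite subr_eq0 eq_sym.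
have fs' := fourier_system_conj fs.
split; apply: (mulIf aa'); rewrite mul0r.
- by rewrite (freq1_mean fs) dd0 mul0r.
- by rewrite (freq1_mean' fs) dd0 mul0r oppr0.
- by rewrite (freq1_mean fs') bb0 mul0r.
- by rewrite (freq1_mean' fs') bb0 mul0r oppr0.
Qed.

(** With equal means, Cramer's rule reads y y' (a mm - 1) = 0. If a mm = 1, the mean equation
    becomes (mm - 1)^2 = p = (mm - 1) (mmb - 1), impossible as p <> 0 and mm <> mmb. *)
Lemma fs_same_mean x y x' y' mm mmb : fourier_system p mm mmb a x y a x' y' ->
  p = (mm - 1) * (mmb - 1) -> mm != mmb -> y * y' = 0.
Proof.
move=> fs1 pE mN.
have := freq1_mean fs1; rewrite subrr mulr0 => /esym/eqP.
rewrite mulf_eq0 => /orP[/eqP//|/eqP am1].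
have am : a * mm = 1 by apply/subr0_eq.
case: fs1 => f0 _ _ _ _ _.
have /eqP : (mm - 1) * (mm - mmb) = 0.
  apply: (eqr_by (eqrZ (- mm ^+ 2) f0)); rewrite pE; ring: am.
rewrite mulf_eq0 !subr_eq0 (negbTE mN) orbF => /eqP m1.
by move: p_neq0; rewrite pE m1 subrr mul0r eqxx.
Qed.

Lemma fs_mean_neq : a != a'.
Proof.
apply/eqP => aa; move: (fs); rewrite -aa => fs1.
have dd0 := fs_same_mean fs1 p_def m_neq.
have bb0 : b * b' = 0.
  by apply: (fs_same_mean (fourier_system_conj fs1)); rewrite 1?mulrC// eq_sym.
case: fs1 => f0 f1 f2 e0 _ _.
have sq0 (x y : F) : x + y = 0 -> x * y = 0 -> x = 0 /\ y = 0.
  move=> /eqP; rewrite addr_eq0 => /eqP ->/eqP.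
  by rewrite mulNr oppr_eq0 mulf_eq0 orbb => /eqP ->; rewrite oppr0.
move: f1 f2; rewrite dd0 bb0 !mulr0 !addr0 => f1 f2.
have [b0 b'0] := sq0 _ _ f1 bb0; have [d0 d'0] := sq0 _ _ f2 dd0.
move: e0; rewrite b0 b'0 d0 d'0 !mul0r !addr0 => a1.
(* Without frequencies a^2 = 1 and 2 a = 2 - p, hence (p - 2)^2 = 4. *)
have : p * (p - 4) = 0.
  by apply: (eqr_by (eqrZ (p - 2 - 2 * a) f0)); ring: a1.
move/eqP; rewrite mulf_eq0 subr_eq0.
by rewrite (negbTE p_neq0) (negbTE p_neq4).
Qed.

Let D_neq0 : a' - a != 0. Proof. by rewrite subr_eq0 eq_sym fs_mean_neq. Qed.

Lemma fs_bb : b * b' * (a' - a) ^+ 2 = - ((d * d') ^+ 2 * (X * X')).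
Proof.
rewrite (_ : _ * _ ^+ 2 = (b * (a' - a)) * (b' * (a' - a))); last by ring.
by rewrite (freq1_mean fs) (freq1_mean' fs); rewrite /X /X'; ring.
Qed.

Lemma fs_dd : d * d' * (a' - a) ^+ 2 = - ((b * b') ^+ 2 * (Y * Y')).
Proof.
have fs' := fourier_system_conj fs.
rewrite (_ : _ * _ ^+ 2 = (d * (a' - a)) * (d' * (a' - a))); last by ring.
by rewrite (freq1_mean fs') (freq1_mean' fs'); rewrite /Y /Y'; ring.
Qed.

Lemma fs_const : d * d' = 0 -> [/\ b = 0, b' = 0, d = 0 & d' = 0].
Proof.
move=> dd0; apply: fs_freq_zero => //; last exact: fs_mean_neq.
apply: (mulIf (expf_neq0 2 D_neq0)).
by rewrite fs_bb dd0 expr0n /= !mul0r oppr0.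
Qed.

Hypothesis dd_neq0 : d * d' != 0.

(** [fs_bb] gives b b' from (d d')^2 and [fs_dd] gives d d' from (b b')^2; composed, they relate d
    d' to (d d')^4. So a and a' fix d d' up to a cube root of unity. *)
Lemma fs_dd_cube :
  (d * d') ^+ 3 * ((X * X') ^+ 2 * (Y * Y')) = - (a' - a) ^+ 6.
Proof.
apply: (mulfI dd_neq0).
apply: (@eqr_by _ (d * d' * (a' - a) ^+ 2 * (a' - a) ^+ 4)
   (- ((b * b') ^+ 2 * (Y * Y')) * (a' - a) ^+ 4)).
  by rewrite fs_dd.
rewrite (_ : - (_ ^+ 2 * _) * _ = - ((b * b' * (a' - a) ^+ 2) ^+ 2 * (Y * Y'))); last by ring.
by rewrite fs_bb; ring.
Qed.

Lemma fs_dd_cube_coef : (X * X') ^+ 2 * (Y * Y') != 0.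
Proof.
apply/eqP => z0; move: fs_dd_cube; rewrite z0 mulr0 => /esym/eqP.
by rewrite oppr_eq0 (negbTE (expf_neq0 6 D_neq0)).
Qed.

(** The trace of pi, as m = 1 + pi. *)
Let A := m + mb - 2.

(** Multiplying [fs_bb] and [fs_dd] gives s t X X' Y Y' = D^4, and [fs_inv0] gives s t (X Y' + X' Y)
    = (mu - 1) D^2. Eliminating s t leaves a relation symmetric in a and a', hence polynomial in mu
    because a + a' = 1 - (p - 1) mu. *)
Lemma fs_cubic (mu := a * a') :
  ((p ^+ 2 - 3 * p - A) * mu - (p - A)) *
  ((1 - 3 * p - A * p) * mu ^+ 2 - (p + 2) * mu + 1) = 0.
Proof.
have fs' := fourier_system_conj fs.
set D := a' - a; set s := b * b'; set t := d * d'.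
have D0 : D != 0 := D_neq0.
have sE : s * D ^+ 2 = - (t ^+ 2 * (X * X')) := fs_bb.
have tE : t * D ^+ 2 = - (s ^+ 2 * (Y * Y')) := fs_dd.
have s0 : s != 0.
  apply/eqP => s0; move/eqP: tE; rewrite s0 expr0n /= mul0r oppr0.
  by rewrite mulf_eq0 (negbTE dd_neq0) (negbTE (expf_neq0 2 D0)).
have stE : s * t * (X * X' * (Y * Y')) = D ^+ 4.
  apply: (mulfI (mulf_neq0 s0 (dd_neq0 : t != 0))).
  apply: (@eqr_by _ (- (t ^+ 2 * (X * X')) * - (s ^+ 2 * (Y * Y'))) (s * D ^+ 2 * (t * D ^+ 2))).
    by rewrite sE tE.
  by ring.
have e : (mu - 1) * D ^+ 2 = s * t * (X * Y' + X' * Y).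
  have bE : b * D = t * X := freq1_mean fs.
  have b'E : b' * D = - (t * X') := freq1_mean' fs.
  have dE : d * D = s * Y := freq1_mean fs'.
  have d'E : d' * D = - (s * Y') := freq1_mean' fs'.
  have e0 := fs_inv0 fs.
  apply: (eqr_by (eqrZ (D ^+ 2) e0)).
  rewrite (_ : s * t * _ = - ((t * X) * (- (s * Y')) + (s * Y) * (- (t * X')))); last by ring.
  by rewrite -bE -b'E -dE -d'E /mu; ring.
have key : (mu - 1) * (X * X' * (Y * Y')) = D ^+ 2 * (X * Y' + X' * Y).
  apply: (mulIf (expf_neq0 2 D0)).
  rewrite mulrAC e -[RHS]mulrAC -exprD -stE.
  by ring.
have sg : a + a' = 1 - (p - 1) * mu.
  by apply: (eqr_by (fs_mean fs)); rewrite /mu; ring.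
have Dsg : D ^+ 2 = (1 - (p - 1) * mu) ^+ 2 - 4 * mu by rewrite -sg /D /mu; ring.
have XX : X * X' = m ^+ 2 * mu - m * (1 - (p - 1) * mu) + 1 by rewrite -sg /X /X' /mu; ring.
have YY : Y * Y' = mb ^+ 2 * mu - mb * (1 - (p - 1) * mu) + 1 by rewrite -sg /Y /Y' /mu; ring.
have XY : X * Y' + X' * Y = 2 * m * mb * mu - (m + mb) * (1 - (p - 1) * mu) + 2.
  by rewrite -sg /X /X' /Y /Y' /mu; ring.
rewrite XX YY XY Dsg in key.
by apply: (eqr_by key); rewrite /A p_def; ring.
Qed.

End One.

(** For given means, d d' determines b b' by [fs_bb], and Cramer's rule then gives all
    frequencies. *)
Lemma fs_inj a b d a' b' d' x y x' y' :
  fourier_system p m mb a b d a' b' d' -> fourier_system p m mb a x y a' x' y' ->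
  d * d' = y * y' -> [/\ b = x, b' = x', d = y & d' = y'].
Proof.
move=> fs1 fs2 dd.
have D0 : a' - a != 0 by rewrite subr_eq0 eq_sym (fs_mean_neq fs1).
have bb : b * b' = x * x'.
  by apply: (mulIf (expf_neq0 2 D0)); rewrite (fs_bb fs1) (fs_bb fs2) dd.
have [gs1 gs2] := (fourier_system_conj fs1, fourier_system_conj fs2).
split; apply: (mulIf D0).
- by rewrite (freq1_mean fs1) (freq1_mean fs2) dd.
- by rewrite (freq1_mean' fs1) (freq1_mean' fs2) dd.
- by rewrite (freq1_mean gs1) (freq1_mean gs2) bb.
- by rewrite (freq1_mean' gs1) (freq1_mean' gs2) bb.
Qed.

Variable w : F.
Hypothesis w_def : w ^+ 2 = - 1 - w.

(** The effect of a cyclic shift of the triple on its Fourier coefficients, z being a power of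
    omega. *)
Lemma fs_rotate z a b d a' b' d' : z ^+ 3 = 1 ->
  fourier_system p m mb a b d a' b' d' ->
  fourier_system p m mb a (z * b) (z ^+ 2 * d) a' (z * b') (z ^+ 2 * d').
Proof.
move=> z3 [f0 f1 f2 e0 e1 e2]; split => //.
- by apply: (eqr_by (eqrZ z f1)); ring: z3.
- by apply: (eqr_by (eqrZ (z ^+ 2) f2)); ring: z3.
- by apply: (eqr_by e0); ring: z3.
- by apply: (eqr_by (eqrZ z e1)); ring: z3.
- by apply: (eqr_by (eqrZ (z ^+ 2) e2)); ring: z3.
Qed.

(** By [fs_dd_cube] the products d d' and y y' have the same cube; a rotation makes them equal, and
    [fs_inj] applies. *)
Lemma fs_orbit a b d a' b' d' x y x' y' :
  fourier_system p m mb a b d a' b' d' -> fourier_system p m mb a x y a' x' y' ->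
  d * d' != 0 -> y * y' != 0 ->
  exists2 k : 'I_3, x = w ^+ k * b & y = w ^+ (2 * k) * d.
Proof.
move=> fs1 fs2 dd0 yy0.
have w3 : w ^+ 3 = 1 by ring: w_def.
have cube : (d * d') ^+ 3 = (y * y') ^+ 3.
  apply: (mulIf (fs_dd_cube_coef fs1 dd0)).
  by rewrite (fs_dd_cube fs1 dd0) (fs_dd_cube fs2 yy0).
pose s := d * d'; pose t := y * y'.
have : (t - s) * ((t - w * s) * (t - w ^+ 2 * s)) = 0.
  by apply: (eqr_by (eqrZ (- 1) cube)); rewrite /t /s; ring: w_def.
move/eqP; rewrite !mulf_eq0 !subr_eq0 => /or3P[] /eqP tE.
- have [-> _ -> _] := fs_inj fs1 fs2 (esym tE).
  by exists 0 => /=; rewrite mul1r.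
(* Rotation by w multiplies d d' by w^4 = w. *)
- have fs3 := fs_rotate w3 fs1.
  have [|<- _ <- _] := fs_inj fs3 fs2; last by exists 1.
  rewrite -/t tE /s; ring: w_def.
- have fs3 := fs_rotate w3 (fs_rotate w3 fs1).
  have [|<- _ <- _] := fs_inj fs3 fs2; last first.
    by exists (@Ordinal 3 2 isT) => /=; ring.
  rewrite -/t tE /s; ring: w_def.
Qed.

End FourierSolutions.

(** * Explicit solutions over a field *)

Section Explicit.
Variables (F : fieldType) (i : F).
Hypothesis i_def : i ^+ 2 = - 1.
Hypothesis two_neq0 : 2 != 0 :> F.

(* Dividing the first frequency and multiplying the second one by [rho] leaves
   only [rho ^+ 3] in the equations. *)
Lemma fourier_system_twist (u pi pib rho al f g al' f' g' : F) :
  u != 0 -> rho != 0 -> rho ^+ 3 * u = pi -> pi * pib = u ^+ 2 ->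
  al + al' + (u ^+ 2 - 1) * (al * al') = 1 ->
  u * (f + f') + pi * (1 + pi) * (g * g') = 0 ->
  u * (g + g') + pib * (1 + pib) * (f * f') = 0 ->
  al * al' + f * g' + g * f' = 1 ->
  u * (al * f' + f * al') + pi * (g * g') = 0 ->
  u * (al * g' + g * al') + pib * (f * f') = 0 ->
  fourier_system (u ^+ 2) (1 + pi) (1 + pib)
    al (f / rho) (g * rho) al' (f' / rho) (g' * rho).
Proof.
move=> u0 r0 piE ppE h0 h1 h2 e0 e1 e2.
have pibE : pib * rho ^+ 3 = u.
  by apply: (mulfI u0); rewrite -expr2 -ppE -piE; ring.
split.
- exact: h0.
- apply: (mulfI (mulf_neq0 r0 u0)); rewrite mulr0 -h1.
  by rewrite -{2}piE; field.
- apply: (mulfI (mulf_neq0 r0 u0)).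
  apply: (eqr_by (eqrZ (rho ^+ 2) h2)); rewrite -{1}pibE; field: pibE => //.
- by rewrite -e0; field.
- apply: (mulfI (mulf_neq0 r0 u0)); rewrite mulr0 -e1 -piE.
  by field.
- apply: (mulfI (mulf_neq0 r0 u0)).
  apply: (eqr_by (eqrZ (rho ^+ 2) e2)); field: pibE => //.
Qed.

Variables (rho al be ga al' be' ga' : F).

(** With rho = e^(i theta), these are the Fourier coefficients of al + be cos(theta - 2 pi j / 3) +
    ga sin(theta - 2 pi j / 3) and of its inverse. *)
Let explicit_system p pi pib := fourier_system p (1 + pi) (1 + pib)
  al ((be + i * ga) / 2 / rho) ((be - i * ga) / 2 * rho)
  al' ((be' + i * ga') / 2 / rho) ((be' - i * ga') / 2 * rho).

(** The identity behind [sol3], with u = sqrt p and r1 r2 / 4 = 3 sqrt 3 B. Changing the signs of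
    both r1 and r2 inverts the triple and preserves r1 r2, hence pi. Over a general field the
    radicals may also be negative or imaginary, which serves [sol2]. *)
Lemma explicit_radical (u v r1 r2 : F)
    (A := (v ^+ 2 - u ^+ 2 - 16) / 4) (D := u ^+ 2 - u * v + 2)
    (pi := (A + i * (r1 * r2 / 4)) / 2) (pib := (A - i * (r1 * r2 / 4)) / 2) :
  u != 0 -> D != 0 -> rho != 0 -> rho ^+ 3 * u = pi ->
  r1 ^+ 2 = (u + v) ^+ 2 - 16 -> r2 ^+ 2 = 16 - (u - v) ^+ 2 ->
  al = (- (1 / 2) * (u ^+ 2 + u * v - 4) - u / 2 * r1) / D ->
  be = ((A + 2) * u - 1 / 4 * (u ^+ 2 - u * v + 4) * r1) / D ->
  ga = (u * (r1 * r2 / 4) + 1 / 4 * (u ^+ 2 + u * v - 4) * r2) / D ->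
  al' = (- (1 / 2) * (u ^+ 2 + u * v - 4) + u / 2 * r1) / D ->
  be' = ((A + 2) * u + 1 / 4 * (u ^+ 2 - u * v + 4) * r1) / D ->
  ga' = (u * (r1 * r2 / 4) - 1 / 4 * (u ^+ 2 + u * v - 4) * r2) / D ->
  explicit_system (u ^+ 2) pi pib /\ al * al' = 2 / D.
Proof.
rewrite /explicit_system => u0 D0 r0 piE h1 h2 -> -> -> -> -> ->.
have four0 : 4 != 0 :> F by rewrite (_ : 4 = 2 * 2 :> F) ?mulf_neq0//; ring.
have eight0 : 8 != 0 :> F by rewrite (_ : 8 = 2 * 4 :> F) ?mulf_neq0//; ring.
split; first apply: fourier_system_twist => //; rewrite /pi /pib /A;
  rewrite /D in D0 *;
  by field: i_def h1 h2; do ?[apply/andP; split].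
Qed.

(** The identity behind [sol1], with r = sqrt (p - 4) and t = 3 sqrt 3 B: changing the sign of r
    inverts the triple. The product of the means is the root of the linear factor in [fs_cubic]. *)
Lemma explicit_quadratic (u r A t : F) (p := u ^+ 2) (D := p ^+ 2 - 3 * p - A)
    (pi := (A + i * t) / 2) (pib := (A - i * t) / 2) (K := p * A - 2 * p - 2 * A) :
  u != 0 -> D != 0 -> rho != 0 -> rho ^+ 3 * u = pi ->
  r ^+ 2 = p - 4 -> t ^+ 2 = 4 * p - A ^+ 2 ->
  al = (K + i * (u * r * t)) / (2 * D) ->
  be = (- (u * (p - 4) * (A + 2)) - i * (r * (p - 2) * t)) / (2 * D) ->
  ga = (- (u * (p - 4) * t) + i * (r * K)) / (2 * D) ->
  al' = (K - i * (u * r * t)) / (2 * D) ->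
  be' = (- (u * (p - 4) * (A + 2)) + i * (r * (p - 2) * t)) / (2 * D) ->
  ga' = (- (u * (p - 4) * t) - i * (r * K)) / (2 * D) ->
  explicit_system p pi pib /\ al * al' = (p - A) / D.
Proof.
rewrite /explicit_system => u0 D0 r0 piE h1 h2 -> -> -> -> -> ->.
have four0 : 4 != 0 :> F by rewrite (_ : 4 = 2 * 2 :> F) ?mulf_neq0//; ring.
have eight0 : 8 != 0 :> F by rewrite (_ : 8 = 2 * 4 :> F) ?mulf_neq0//; ring.
split; first apply: fourier_system_twist => //; rewrite /pi /pib /K;
  rewrite /D /p in D0 h1 h2 *;
  by field: i_def h1 h2; do ?[apply/andP; split].
Qed.

End Explicit.

(** * Triples of complex numbers and their orbits *)

Section Cardinal.

Lemma card_setU_disjoint (T : choiceType) (X Y : set T) (m n : nat) :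
  X #= `I_m -> Y #= `I_n -> (forall t, X t -> ~ Y t) -> X `|` Y #= `I_(m + n).
Proof.
move=> Xm Yn XY.
have [finX finY] : finite_set X /\ finite_set Y by split; apply/finite_setP; eexists; eassumption.
have finU : finite_set (X `|` Y) by rewrite finite_setU.
rewrite -(fset_setK finU); apply/card_eq_fsetP.
rewrite fset_setU// cardfsU (card_fset_set Xm) (card_fset_set Yn).
rewrite -fset_setI// (_ : X `&` Y = set0) ?fset_set0 ?cardfs0 ?subn0//.
by apply/seteqP; split=> // t [/XY].
Qed.

Lemma card_range_fin (I : finType) (T : Type) (f : I -> T) (n : nat) :
  injective f -> #|I| = n -> range f #= `I_n.
Proof.
move=> f_inj In; apply: (card_eq_trans (inj_card_eq (in2W f_inj))).
have -> : [set: I] = [set` [fset x | x in I]%fset].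
  by apply/seteqP; split => x //= _; apply/imfsetP; exists x.
by apply/card_eq_fsetP; rewrite card_imfset//= -cardE.
Qed.

End Cardinal.

(** * Fourier transform of complex triples *)

Section Omega.
Local Open Scope complex_scope.
Context {R : realType}.
Definition omega : R[i] := (- 1 + 'i * (Num.sqrt 3)%:C) / 2.

Lemma sqr_iC : 'i ^+ 2 = - 1 :> R[i].
Proof. exact: sqr_i. Qed.

Lemma sqr_sqrt3C : (Num.sqrt 3)%:C ^+ 2 = 3 :> R[i].
Proof. by rewrite -rmorphXn /= sqr_sqrtr// rmorph_nat. Qed.

Lemma omega_def : omega ^+ 2 = - 1 - omega.
Proof. by rewrite /omega; field: sqr_iC sqr_sqrt3C. Qed.

Lemma omega3 : omega ^+ 3 = 1.
Proof. by ring: omega_def. Qed.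

Lemma omega_neq0 : omega != 0.
Proof. by apply/eqP => w0; move/eqP: omega3; rewrite w0 expr0n /= eq_sym oner_eq0. Qed.

Definition mean (c : triple R) : R[i] := (c 0 + c 1 + c 2) / 3.
Definition freq1 (c : triple R) : R[i] := (c 0 + omega ^+ 2 * c 1 + omega * c 2) / 3.
Definition freq2 (c : triple R) : R[i] := (c 0 + omega * c 1 + omega ^+ 2 * c 2) / 3.
(** The exponent 2 j stands for - j, since omega^3 = 1. *)
Definition synth (a b d : R[i]) : triple R :=
  [ffun j : 'I_3 => a + b * omega ^+ j + d * omega ^+ (2 * j)].

Definition tinv (c : triple R) : triple R := [ffun j => (c j)^-1].

Lemma ord3P (P : 'I_3 -> Prop) : P 0 -> P 1 -> P 2 -> forall j, P j.
Proof.
move=> P0 P1 P2; case=> [[|[|[|//]]] jlt].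
- by rewrite (_ : Ordinal jlt = 0)//; apply: val_inj.
- by rewrite (_ : Ordinal jlt = 1)//; apply: val_inj.
- by rewrite (_ : Ordinal jlt = 2)//; apply: val_inj.
Qed.

Lemma synth0 a b d : synth a b d 0 = a + b + d.
Proof. by rewrite ffunE /=; ring. Qed.

Lemma synth1 a b d : synth a b d 1 = a + b * omega + d * omega ^+ 2.
Proof. by rewrite ffunE /=; ring. Qed.

Lemma synth2 a b d : synth a b d 2 = a + b * omega ^+ 2 + d * omega.
Proof. by rewrite ffunE /=; ring: omega_def. Qed.

Lemma mean_synth a b d : mean (synth a b d) = a.
Proof. by rewrite /mean synth0 synth1 synth2; field: omega_def. Qed.

Lemma freq1_synth a b d : freq1 (synth a b d) = b.
Proof. by rewrite /freq1 synth0 synth1 synth2; field: omega_def. Qed.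

Lemma freq2_synth a b d : freq2 (synth a b d) = d.
Proof. by rewrite /freq2 synth0 synth1 synth2; field: omega_def. Qed.

Lemma synthK c : synth (mean c) (freq1 c) (freq2 c) = c.
Proof.
apply/ffunP; apply: ord3P; rewrite ?synth0 ?synth1 ?synth2 /mean /freq1 /freq2;
  by field: omega_def.
Qed.

Lemma shift_synth a b d k :
  shift (synth a b d) k = synth a (omega ^+ k * b) (omega ^+ (2 * k) * d).
Proof.
have w23 : (omega ^+ 2) ^+ 3 = 1 by rewrite exprAC omega3 expr1n.
apply/ffunP => j; rewrite !ffunE /= [omega ^+ (2 * (_ %% 3))]exprM.
by rewrite (expr_mod _ omega3) (expr_mod _ w23) -exprM !mulnDr !exprD; ring.
Qed.

Lemma tinvK : involutive tinv.
Proof. by move=> c; apply/ffunP => j; rewrite !ffunE invrK. Qed.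

Lemma shiftV_shift c k : shiftV c k = shift (tinv c) k.
Proof. by apply/ffunP => j; rewrite !ffunE. Qed.

Lemma tinv_shift c k : tinv (shift c k) = shift (tinv c) k.
Proof. by apply/ffunP => j; rewrite !ffunE. Qed.

Section Params.
Variables p A B : R.

(** The element pi of norm p; for the integers A and B of the theorem it is, up to conjugation, the
    Jacobi sum J(chi, chi) of a cubic character chi modulo p. *)
Definition jacobi : R[i] := (A%:C + 'i * (3 * Num.sqrt 3 * B)%:C) / 2.
Definition jacobi_conj : R[i] := (A%:C - 'i * (3 * Num.sqrt 3 * B)%:C) / 2.

Definition fourier_triple (c c' : triple R) :=
  fourier_system p%:C (1 + jacobi) (1 + jacobi_conj)
    (mean c) (freq1 c) (freq2 c) (mean c') (freq1 c') (freq2 c').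

Let n1E : (n12 p A)%:C = (p%:C - 1 + (1 + jacobi) + (1 + jacobi_conj)) / 9.
Proof. by rewrite /n12 /jacobi /jacobi_conj; field: sqr_iC sqr_sqrt3C. Qed.

Let n2E : (n02 p A B)%:C = (p%:C - 1 + omega ^+ 2 * (1 + jacobi) + omega * (1 + jacobi_conj)) / 9.
Proof. by rewrite /n02 /jacobi /jacobi_conj /omega; field: sqr_iC sqr_sqrt3C. Qed.

Let n3E : (n01 p A B)%:C = (p%:C - 1 + omega * (1 + jacobi) + omega ^+ 2 * (1 + jacobi_conj)) / 9.
Proof. by rewrite /n01 /jacobi /jacobi_conj /omega; field: sqr_iC sqr_sqrt3C. Qed.

Let pE : ((p - 4) / 3)%:C = (p%:C - 4) / 3. Proof. by field. Qed.

Let three_neq0 : 3 != 0 :> R[i]. Proof. by rewrite pnatr_eq0. Qed.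

Lemma solution_fourier c : solutions p A B c -> fourier_triple c (tinv c).
Proof.
case=> c0 []; rewrite !div1r n1E n2E n3E pE => e0 e1 e2.
rewrite /fourier_triple /mean /freq1 /freq2 !ffunE.
by apply: class_eq_fourier; rewrite ?mulfV ?c0 //; exact: omega_def.
Qed.

Lemma fourier_solution a b d a' b' d' :
  fourier_system p%:C (1 + jacobi) (1 + jacobi_conj) a b d a' b' d' ->
  solutions p A B (synth a b d) /\ tinv (synth a b d) = synth a' b' d'.
Proof.
move=> fs.
have [i0 i1 i2] := fourier_inv omega_def fs.
have [e0 e1 e2] := fourier_class_eq omega_def three_neq0 fs.
have invE : tinv (synth a b d) = synth a' b' d'.
  have VE (x y : R[i]) : x * y = 1 -> x^-1 = y.
    move=> xy; have x0 : x != 0.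
      by apply/eqP => x0; move/eqP: xy; rewrite x0 mul0r eq_sym oner_eq0.
    by apply: (mulfI x0); rewrite mulfV.
  apply/ffunP; rewrite /tinv; apply: ord3P; rewrite [LHS]ffunE;
    by apply: VE; rewrite ?synth0 ?synth1 ?synth2.
have invE' j : (synth a b d j)^-1 = synth a' b' d' j by rewrite -invE [RHS]ffunE.
split=> //; split.
  (* As 0^-1 = 0, [invE'] leaves zero components possible; c_j c_j' = 1 excludes them. *)
  move=> j; rewrite -invr_eq0 invE'; apply/eqP => z.
  have := invE' j; rewrite z => /eqP; rewrite invr_eq0.
  move: j z; apply: ord3P; rewrite ?synth0 ?synth1 ?synth2 => z /eqP z'.
  - by move/eqP: i0; rewrite z' mul0r eq_sym oner_eq0.
  - by move/eqP: i1; rewrite z' mul0r eq_sym oner_eq0.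
  - by move/eqP: i2; rewrite z' mul0r eq_sym oner_eq0.
rewrite /system !div1r n1E n2E n3E pE !invE' !(synth0, synth1, synth2).
by split.
Qed.

End Params.
End Omega.

(** * Orbits of solutions and their invariant mu *)

Section Classification.
Local Open Scope complex_scope.
Context {R : realType}.
Variables p A B : R.
Hypothesis p_gt4 : 4 < p.
Hypothesis pAB : 4 * p = A ^+ 2 + 27 * B ^+ 2.
Hypothesis B_gt0 : 0 < B.

Local Notation S := (solutions p A B).
Local Notation J := (jacobi A B).
Local Notation Jb := (jacobi_conj A B).
Implicit Types c : triple R.

Lemma sqrAC : A%:C ^+ 2 = 4 * p%:C - 27 * B%:C ^+ 2.
Proof.
rewrite -!rmorphXn /= (_ : A ^+ 2 = 4 * p - 27 * B ^+ 2); first by ring.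
by rewrite pAB; ring.
Qed.

Lemma jacobi_norm : J * Jb = p%:C.
Proof. by rewrite /jacobi /jacobi_conj; field: (@sqr_iC R) (@sqr_sqrt3C R) sqrAC. Qed.

Lemma p_def : p%:C = (1 + J - 1) * (1 + Jb - 1).
Proof. by rewrite -jacobi_norm; ring. Qed.

Lemma pC_neq0 : p%:C != 0 :> R[i].
Proof. by rewrite fmorph_eq0 gt_eqF// (lt_trans _ p_gt4). Qed.

Lemma pC_neq4 : p%:C != 4 :> R[i].
Proof.
rewrite (_ : 4 = 4%:C); last by rewrite rmorph_nat.
by rewrite (inj_eq (@complexI R)) gt_eqF.
Qed.

Lemma jacobi_neq : 1 + J != 1 + Jb.
Proof.
rewrite -subr_eq0 (_ : _ - _ = 'i * (3 * Num.sqrt 3 * B)%:C); last first.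
  by rewrite /jacobi /jacobi_conj; field.
rewrite mulf_neq0//; first by rewrite eq_complex /= oner_eq0 andbF.
by rewrite fmorph_eq0 gt_eqF// !mulr_gt0// sqrtr_gt0.
Qed.

Definition mean_prod c := mean c * mean (tinv c).
(** For a solution, the vanishing of this single product already makes all frequencies zero, by
    [fs_const]. *)
Definition nonconst c := freq2 c * freq2 (tinv c) != 0.

Lemma solutionP c : S c <-> fourier_triple p A B c (tinv c).
Proof.
split=> [|fs]; first exact: solution_fourier.
by have [] := fourier_solution fs; rewrite synthK.
Qed.

Lemma solution_tinv c : S c -> S (tinv c).
Proof. by rewrite !solutionP tinvK => /fourier_systemC. Qed.

Lemma mean_shift c k : mean (shift c k) = mean c.
Proof. by rewrite -[in LHS](synthK c) shift_synth mean_synth. Qed.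

Lemma freq1_shift c k : freq1 (shift c k) = omega ^+ k * freq1 c.
Proof. by rewrite -[in LHS](synthK c) shift_synth freq1_synth. Qed.

Lemma freq2_shift c k : freq2 (shift c k) = omega ^+ (2 * k) * freq2 c.
Proof. by rewrite -[in LHS](synthK c) shift_synth freq2_synth. Qed.

Lemma solution_shift c k : S c -> S (shift c k).
Proof.
rewrite !solutionP tinv_shift /fourier_triple.
rewrite !mean_shift !freq1_shift !freq2_shift mulnC exprM => fs.
by apply: fs_rotate => //; rewrite exprAC omega3 expr1n.
Qed.

Lemma mean_neq c : S c -> mean c != mean (tinv c).
Proof.
move=> /solution_fourier fs.
exact: (fs_mean_neq p_def pC_neq0 pC_neq4 jacobi_neq fs).
Qed.

Lemma tinv_neq c : S c -> tinv c <> c.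
Proof. by move=> /mean_neq /eqP + e; rewrite e. Qed.

Lemma nonconst_freq2 c : nonconst c -> freq2 c != 0.
Proof. by rewrite /nonconst mulf_eq0 negb_or => /andP[]. Qed.

Lemma nonconst_tinv c : nonconst c -> nonconst (tinv c).
Proof. by rewrite /nonconst tinvK mulrC. Qed.

Lemma omega_expr_inj : injective (fun k : 'I_3 => omega (R := R) ^+ (2 * k)).
Proof.
have [w0 w1] : omega (R := R) != 0 /\ omega (R := R) != 1.
  split; first exact: omega_neq0.
  apply/eqP => w1; have := @omega_def R; rewrite w1 => /eqP.
  by rewrite -subr_eq0 (_ : _ - _ = 3%:R) ?pnatr_eq0//; ring.
have w21 : omega (R := R) ^+ 2 != 1.
  apply: contraNneq w1 => w21; have := @omega3 R.
  by rewrite exprSr w21 mul1r => ->.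
have w2w : omega (R := R) ^+ 2 != omega.
  by apply: contraNneq w1 => e; apply/eqP/(mulfI w0); rewrite -expr2 e mulr1.
have w4 : omega (R := R) ^+ 4 = omega by ring: (@omega_def R).
apply: ord3P; apply: ord3P => //=; rewrite ?modn_small ?expr0 //= ?w4 => /eqP.
all: rewrite ?(negbTE w21) ?(negbTE w2w) ?(negbTE w1) //.
all: rewrite eq_sym ?(negbTE w21) ?(negbTE w2w) ?(negbTE w1) //.
Qed.

Lemma shift_inj c : nonconst c -> injective (shift c).
Proof.
move=> /nonconst_freq2 nc k l /(congr1 freq2); rewrite !freq2_shift.
by move=> /(mulIf nc) /omega_expr_inj.
Qed.

(** The shifts of c differ because freq2 c <> 0 is multiplied by distinct powers of omega; shifts of
    c and of 1/c differ by their means. *)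
Lemma card_transforms c : S c -> nonconst c -> transforms c #= `I_6.
Proof.
move=> Sc nc; apply: (@card_setU_disjoint _ _ _ 3 3).
- by apply: card_range_fin (card_ord 3); exact: shift_inj.
- rewrite (_ : shiftV c = shift (tinv c)); last by apply/funext => k; exact: shiftV_shift.
  by apply: card_range_fin (card_ord 3); apply: shift_inj; exact: nonconst_tinv.
- move=> _ [k _ <-] [l _]; rewrite shiftV_shift => /(congr1 mean).
  by rewrite !mean_shift => e; move: (mean_neq Sc); rewrite e eqxx.
Qed.

Lemma transformsP c (P : triple R -> Prop) :
  (forall k, P (shift c k)) -> (forall k, P (shift (tinv c) k)) ->
  forall c', transforms c c' -> P c'.
Proof. by move=> h1 h2 c' [[k _ <-]//|[k _ <-]]; rewrite shiftV_shift. Qed.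

Lemma transforms_solution c c' : S c -> transforms c c' -> S c'.
Proof.
move=> Sc; move: c'; apply: transformsP => k; apply: solution_shift => //.
exact: solution_tinv.
Qed.

Lemma transforms_mean_prod c c' : transforms c c' -> mean_prod c' = mean_prod c.
Proof.
move: c'; rewrite /mean_prod; apply: transformsP => k; rewrite tinv_shift !mean_shift//.
by rewrite tinvK mulrC.
Qed.

Lemma transforms_nonconst c c' : nonconst c -> transforms c c' -> nonconst c'.
Proof.
move=> nc; have h k c1 : nonconst c1 -> nonconst (shift c1 k).
  rewrite /nonconst tinv_shift !freq2_shift !mulf_eq0 !expf_eq0.
  by rewrite (negbTE (@omega_neq0 R)) !andbF.
move: c'; apply: transformsP => k; apply: h => //; exact: nonconst_tinv.
Qed.

Lemma shift_mean c c0 : S c -> S c0 -> nonconst c -> nonconst c0 ->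
  mean c = mean c0 -> mean (tinv c) = mean (tinv c0) -> exists k, c = shift c0 k.
Proof.
move=> /solution_fourier fs /solution_fourier fs0 nc nc0 e e'.
rewrite /fourier_triple e e' in fs.
have [k e1 e2] := fs_orbit p_def pC_neq0 pC_neq4 jacobi_neq (@omega_def R) fs0 fs nc0 nc.
exists k; rewrite -(synthK c) -(synthK (shift c0 k)).
by rewrite mean_shift freq1_shift freq2_shift e e1 e2.
Qed.

(** [fs_mean] recovers a + a' from mu = a a', hence the pair {a, a'}. According to its order, c is a
    shift of c0 or of its inverse. *)
Lemma transforms_mean c c0 : S c -> S c0 -> nonconst c -> nonconst c0 ->
  mean_prod c = mean_prod c0 -> transforms c0 c.
Proof.
move=> Sc S0 nc nc0; rewrite /mean_prod => e.
have f := fs_mean (solution_fourier Sc); have f0 := fs_mean (solution_fourier S0).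
have sumE : mean c + mean (tinv c) = mean c0 + mean (tinv c0).
  by apply: (eqr_by (eqrD f (eqrD (eqrZ (-1) f0) (eqrZ (1 - p%:C) e)))); ring.
have : (mean c - mean c0) * (mean c - mean (tinv c0)) = 0.
  by apply: (eqr_by (eqrD (eqrZ (mean c) sumE) (eqrZ (- 1) e))); ring.
move/eqP; rewrite mulf_eq0 !subr_eq0 => /orP[]/eqP h; rewrite h in sumE.
- have h' : mean (tinv c) = mean (tinv c0) by apply: (addrI _ sumE).
  by have [k ->] := shift_mean Sc S0 nc nc0 h h'; left; exists k.
- have h' : mean (tinv c) = mean c0 by apply: (@addrI _ (mean (tinv c0))); rewrite sumE addrC.
  rewrite -[c0]tinvK in h'.
  have [k ->] := shift_mean Sc (solution_tinv S0) nc (nonconst_tinv nc0) h h'.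
  by right; exists k => //; rewrite shiftV_shift.
Qed.

Lemma mean_prod_cubic c : S c -> nonconst c ->
  ((p ^+ 2 - 3 * p - A)%:C * mean_prod c - (p - A)%:C) *
  ((1 - 3 * p - A * p)%:C * mean_prod c ^+ 2 - (p + 2)%:C * mean_prod c + 1) = 0.
Proof.
move=> /solution_fourier fs nc.
have := fs_cubic p_def pC_neq0 pC_neq4 jacobi_neq fs nc.
have -> : 1 + J + (1 + Jb) - 2 = A%:C by rewrite /jacobi /jacobi_conj; field.
by rewrite /mean_prod => h; apply: (eqr_by h); ring.
Qed.

(** Without frequencies the system says a a' = 1 and a + a' = 2 - p, so a is a root of X^2 + (p - 2)
    X + 1, of discriminant p (p - 4). *)
Lemma eps_eqP c : (S c /\ ~~ nonconst c) <-> (c = eps_plus p \/ c = eps_minus p).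
Proof.
set rt := Num.sqrt (p * (p - 4)).
have rt2 : rt%:C ^+ 2 = p%:C * (p%:C - 4).
  have pp0 : 0 <= p * (p - 4) by rewrite mulr_ge0//; move: p_gt4; lra.
  by rewrite -rmorphXn /= sqr_sqrtr//; ring.
have E (e : R[i]) : ([ffun=> e] : triple R) = synth e 0 0.
  by apply/ffunP => j; rewrite !ffunE !mul0r !addr0.
split=> [[Sc nc]|].
  have fs := solution_fourier Sc.
  have [b0 b'0 d0 d'0] : [/\ freq1 c = 0, freq1 (tinv c) = 0, freq2 c = 0 & freq2 (tinv c) = 0].
    apply: (fs_const p_def pC_neq0 pC_neq4 jacobi_neq fs).
    by apply/eqP; rewrite -[_ == 0]negbK.
  have := fs_inv0 fs; have := fs_mean fs; rewrite b0 b'0 !mul0r !addr0 => f0 e0.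
  have : (mean c - ((2 - p + rt) / 2)%:C) * (mean c - ((2 - p - rt) / 2)%:C) = 0.
    apply: (eqr_by (eqrD (eqrZ (mean c) f0) (eqrZ (- 1 - (p%:C - 1) * mean c) e0))).
    by field: rt2.
  have cE : c = [ffun=> mean c] by rewrite E -[LHS]synthK b0 d0.
  by move/eqP; rewrite mulf_eq0 !subr_eq0 => /orP[]/eqP h; rewrite cE h; [left|right].
have key (e e' : R[i]) : e * e' = 1 -> e + e' = 2 - p%:C ->
    S ([ffun=> e] : triple R) /\ ~~ nonconst [ffun=> e].
  move=> h1 h2; rewrite E.
  have [|Ss si] := @fourier_solution R p A B e 0 0 e' 0 0.
    split; rewrite ?(mulr0, mul0r, addr0)//.
    by rewrite h1 h2; ring.
  by split=> //; rewrite /nonconst freq2_synth mul0r eqxx.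
case=> ->; rewrite /eps_plus /eps_minus -/rt.
- by apply: (key _ ((2 - p - rt) / 2)%:C); field: rt2.
- by apply: (key _ ((2 - p + rt) / 2)%:C); field: rt2.
Qed.

(** Constant solutions have a a' = 1 by [fs_inv0]. *)
Lemma mean_prod_nonconst c : S c -> mean_prod c != 1 -> nonconst c.
Proof.
move=> /solution_fourier fs; apply: contraNT => /negPn/eqP nc.
have [b0 b'0 _ _] := fs_const p_def pC_neq0 pC_neq4 jacobi_neq fs nc.
by have := fs_inv0 fs; rewrite b0 b'0 mul0r mulr0 !addr0 => e0; apply/eqP.
Qed.

(** Real components of modulus 1 are 1 or - 1, so the solution would equal its inverse. *)
Lemma real_not_unimodular c : S c -> real_triple c -> ~ unimodular c.
Proof.
move=> Sc rc uc; apply: (tinv_neq Sc); apply/ffunP => j; rewrite ffunE.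
have := rc j; have := uc j; rewrite /unimodular /= => n1 r1.
have /eqP : c j ^+ 2 = 1 by rewrite -real_normK// n1 expr1n.
by rewrite sqrf_eq1 => /orP[]/eqP ->; rewrite ?invrN invr1.
Qed.

Lemma unimodular_conj c : (forall j, c j * (c j)^*%C = 1) -> unimodular c.
Proof.
move=> h j; apply/eqP; rewrite -sqrp_eq1 ?normr_ge0// sqr_normc; exact/eqP.
Qed.

Lemma transforms_unimodular c c' : unimodular c -> transforms c c' -> unimodular c'.
Proof.
move=> uc; move: c'; apply: transformsP => k j; rewrite !ffunE//.
by rewrite normfV uc invr1.
Qed.

Lemma transforms_real c c' : real_triple c -> transforms c c' -> real_triple c'.
Proof.
move=> uc; move: c'; apply: transformsP => k j; rewrite !ffunE//.
by rewrite rpredV.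
Qed.

End Classification.

(** * The three listed solutions *)

Section Trig.
Local Open Scope complex_scope.
Context {R : realType}.
Implicit Types x y : R.

Lemma cos3 x : cos (3 * x) = 4 * cos x ^+ 3 - 3 * cos x.
Proof.
have -> : 3 * x = x + x + x by ring.
have := cos2Dsin2 x; rewrite !(cosD, sinD) => h.
have s2 : sin x ^+ 2 = 1 - cos x ^+ 2 by rewrite -h; ring.
by ring: s2.
Qed.

Lemma sin3 x : sin (3 * x) = 3 * sin x - 4 * sin x ^+ 3.
Proof.
have -> : 3 * x = x + x + x by ring.
have := cos2Dsin2 x; rewrite !(cosD, sinD) => h.
have s2 : cos x ^+ 2 = 1 - sin x ^+ 2 by rewrite -h; ring.
by ring: s2.
Qed.

(** With y = 2 pi / 3, sin(3 y) = 0 and sin y > 0 leave 4 sin^2 y = 3. *)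
Lemma sin_2pi3 : sin (2 * pi / 3) = Num.sqrt 3 / 2 :> R.
Proof.
set y := 2 * pi / 3; have pi0 := pi_gt0 R.
have y0 : 0 < sin y by apply: sin_gt0_pi; rewrite /y; apply/andP; split; lra.
have h : 3 * sin y - 4 * sin y ^+ 3 = 0.
  rewrite -sin3 (_ : 3 * y = pi *+ 2) ?sin2pi// /y; lra.
have s2 : sin y ^+ 2 = 3 / 4.
  apply: (mulfI (lt0r_neq0 y0)).
  by apply: (eqr_by (eqrZ (- (1 / 4)) h)); field.
apply/eqP; rewrite -(@eqrXn2 _ 2)//; last 2 first.
- exact: ltW.
- by rewrite divr_ge0// sqrtr_ge0.
by rewrite s2 expr_div_n sqr_sqrtr//; apply/eqP; field.
Qed.

(** As cos^2 y = 1/4, the identity cos(3 y) = 1 becomes - 2 cos y = 1. *)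
Lemma cos_2pi3 : cos (2 * pi / 3) = - (1 / 2) :> R.
Proof.
set y := 2 * pi / 3.
have c2 : cos y ^+ 2 = 1 / 4.
  have := cos2Dsin2 y; rewrite sin_2pi3 expr_div_n sqr_sqrtr// => h; lra.
have h : 4 * cos y ^+ 3 - 3 * cos y = 1.
  by rewrite -cos3 (_ : 3 * y = pi *+ 2) ?cos2pi// /y; lra.
by move: h; rewrite exprSr c2; lra.
Qed.

End Trig.

(** * Verification of the listed triples *)

Section Solutions.
Local Open Scope complex_scope.
Context {R : realType}.
Variables p A B : R.
Hypothesis p_gt4 : 4 < p.
Hypothesis pAB : 4 * p = A ^+ 2 + 27 * B ^+ 2.
Hypothesis B_gt0 : 0 < B.

Local Notation S := (solutions p A B).
Local Notation J := (jacobi A B).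
Local Notation Jb := (jacobi_conj A B).
Local Notation U := (u p).
Local Notation V := (v p A).
Implicit Types c : triple R.

Lemma u_gt0 : 0 < U. Proof. by rewrite sqrtr_gt0 (lt_trans _ p_gt4). Qed.

Lemma sqr_u : U ^+ 2 = p.
Proof. by rewrite sqr_sqrtr// ltW// (lt_trans _ p_gt4). Qed.

Lemma sqrA_lt : A ^+ 2 < 4 * p.
Proof. by rewrite pAB ltrDl mulr_gt0// exprn_gt0. Qed.

Lemma A_lt : - (2 * U) < A < 2 * U.
Proof.
rewrite -ltr_norml -(ltr_pXn2r (n := 2))// ?nnegrE//; last first.
  by rewrite mulr_ge0// ltW// u_gt0.
by rewrite real_normK ?num_real// exprMn sqr_u -natrX sqrA_lt.
Qed.

(** From A > - 2 U the argument exceeds (U - 4)^2. *)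
Lemma v_arg_gt0 : 0 < p + 4 * A + 16.
Proof.
have /andP[h _] := A_lt; have := sqr_ge0 (U - 4); have := sqr_u.
by rewrite sqrrB => ->; lra.
Qed.

Lemma v_gt0 : 0 < V. Proof. by rewrite sqrtr_gt0 v_arg_gt0. Qed.

Lemma sqr_v : V ^+ 2 = p + 4 * A + 16.
Proof. by rewrite sqr_sqrtr// ltW// v_arg_gt0. Qed.

(** From |A| < 2 U, V^2 lies between (U - 4)^2 and (U + 4)^2. *)
Lemma uv_bounds : [/\ 0 < U + V + 4, 0 < U + V - 4, 0 < 4 + U - V & 0 < 4 - U + V].
Proof.
have /andP[h1 h2] := A_lt; have u0 := u_gt0; have v0 := v_gt0.
have u2 := sqr_u; have v2 := sqr_v.
split; first lra.
- by rewrite ltNge; apply/negP => h; nra.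
- by rewrite ltNge; apply/negP => h; nra.
- by rewrite ltNge; apply/negP => h; nra.
Qed.

Let r1 := Num.sqrt (U + V + 4) * Num.sqrt (U + V - 4).
Let r2 := Num.sqrt (4 + U - V) * Num.sqrt (4 - U + V).

Lemma sqr_r1 : r1 ^+ 2 = (U + V) ^+ 2 - 16.
Proof.
have [h1 h2 h3 h4] := uv_bounds.
by rewrite exprMn !sqr_sqrtr ?ltW//; ring.
Qed.

Lemma sqr_r2 : r2 ^+ 2 = 16 - (U - V) ^+ 2.
Proof.
have [h1 h2 h3 h4] := uv_bounds.
by rewrite exprMn !sqr_sqrtr ?ltW//; ring.
Qed.

(** Both sides are nonnegative, and r1^2 r2^2 = 64 U^2 - (V^2 - U^2 - 16)^2 = 16 (4 p - A^2), where
    4 p - A^2 = 27 B^2. *)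
Lemma r1_r2 : r1 * r2 = 12 * Num.sqrt 3 * B.
Proof.
apply/eqP; rewrite -(@eqrXn2 _ 2)//; last 2 first.
- by rewrite !mulr_ge0// sqrtr_ge0.
- by rewrite !mulr_ge0// ?sqrtr_ge0// ltW.
apply/eqP; rewrite [in LHS]exprMn sqr_r1 sqr_r2 [in RHS]exprMn [in RHS]exprMn sqr_sqrtr//.
have -> : 12 ^+ 2 * 3 * B ^+ 2 = 16 * (27 * B ^+ 2) by ring.
have -> : 27 * B ^+ 2 = 4 * p - A ^+ 2 by rewrite pAB; ring.
have AE : A = (V ^+ 2 - U ^+ 2 - 16) / 4 by rewrite sqr_v sqr_u; field.
by move: (V) (U) AE sqr_u => V' U' -> <-; field.
Qed.

Definition rho : R[i] := (cos (theta p A))%:C + 'i * (sin (theta p A))%:C.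

Lemma rho_conj : rho * ((cos (theta p A))%:C - 'i * (sin (theta p A))%:C) = 1.
Proof.
rewrite /rho; set x := theta p A.
have c2 : (cos x)%:C ^+ 2 = 1 - (sin x)%:C ^+ 2.
  by rewrite -!rmorphXn /= cos2sin2 rmorphB rmorph1.
by ring: (@sqr_iC R) c2.
Qed.

Lemma rho_neq0 : rho != 0.
Proof. by apply/eqP => r0; move/eqP: rho_conj; rewrite r0 mul0r eq_sym oner_eq0. Qed.

Lemma rho_inv : rho^-1 = (cos (theta p A))%:C - 'i * (sin (theta p A))%:C.
Proof. by apply: (mulfI rho_neq0); rewrite mulfV ?rho_neq0// rho_conj. Qed.

(** 3 theta is the argument of pi: its cosine is A / (2 sqrt p), and its sine is nonnegative by the
    range of [acos], in accordance with B > 0. *)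
Lemma rho_cube : rho ^+ 3 * U%:C = J.
Proof.
have u0 := u_gt0; have /andP[A1 A2] := A_lt.
have xE : 3 * theta p A = acos (A / (2 * U)) by rewrite /theta; field.
have xb : -1 <= A / (2 * U) <= 1.
  rewrite ler_pdivlMr ?ler_pdivrMr ?mulr_gt0//; apply/andP; split; lra.
have cE : 4 * cos (theta p A) ^+ 3 - 3 * cos (theta p A) = A / (2 * U).
  by rewrite -cos3 xE acosK.
have sE : 3 * sin (theta p A) - 4 * sin (theta p A) ^+ 3 = 3 * Num.sqrt 3 * B / (2 * U).
  rewrite -sin3 xE sin_acos//.
  rewrite (_ : 1 - _ = (3 * Num.sqrt 3 * B / (2 * U)) ^+ 2); last first.
    rewrite !expr_div_n !exprMn sqr_u (sqr_sqrtr (a := 3))//.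
    have -> : 3 ^+ 2 * 3 * B ^+ 2 = 4 * p - A ^+ 2 by rewrite pAB; ring.
    by field; rewrite gt_eqF// (lt_trans _ p_gt4).
  by rewrite sqrtr_sqr ger0_norm// divr_ge0 ?mulr_ge0 ?sqrtr_ge0// ltW.
have cs := cos2Dsin2 (theta p A).
have s2 : (sin (theta p A))%:C ^+ 2 = 1 - (cos (theta p A))%:C ^+ 2.
  by rewrite -!rmorphXn /= sin2cos2 rmorphB rmorph1.
have uC : U%:C != 0 by rewrite fmorph_eq0 gt_eqF.
have -> : rho ^+ 3 = (4 * cos (theta p A) ^+ 3 - 3 * cos (theta p A))%:C
   + 'i * (3 * sin (theta p A) - 4 * sin (theta p A) ^+ 3)%:C.
  by rewrite /rho; ring: (@sqr_iC R) s2.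
by rewrite cE sE /jacobi; field.
Qed.

(** Euler's formulas, with e^(i (theta - 2 pi j / 3)) = rho omega^(- j). *)
Lemma trig_synth (al be ga : R[i]) : trig_triple p A al be ga =
  synth al ((be + 'i * ga) / 2 / rho) ((be - 'i * ga) / 2 * rho).
Proof.
have tE (j : R) : theta p A - 2 * pi / 3 * j = theta p A - (2 * pi / 3) * j by [].
apply/ffunP; rewrite /trig_triple; apply: ord3P;
  rewrite ffunE ?synth0 ?synth1 ?synth2 rho_inv /rho /=.
- by rewrite mulr0 subr0; field: (@sqr_iC R).
- rewrite mulr1 cosB sinB cos_2pi3 sin_2pi3 /omega.
  by field: (@sqr_iC R) (@sqr_sqrt3C R).
- rewrite (_ : ((1 %% 3 + 1 %% 3) %% 3)%N = 2%N)// mulr_natr mulr2n.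
  rewrite opprD addrA !(cosB, sinB) cos_2pi3 sin_2pi3 /omega.
  by field: (@sqr_iC R) (@sqr_sqrt3C R).
Qed.

Lemma complexDi (x y : R) : x +i* y = x%:C + 'i * y%:C.
Proof. by rewrite [LHS]complexE. Qed.

Let two_neq0 : 2 != 0 :> R[i]. Proof. by rewrite pnatr_eq0. Qed.

Let N := p ^+ 2 - 3 * p - A.

(** From A < 2 U, N exceeds U^4 - 3 U^2 - 2 U = U (U - 2) (U + 1)^2, and U > 2. *)
Lemma N_gt0 : 0 < N.
Proof.
have /andP[h1 h2] := A_lt; have u0 := u_gt0; rewrite /N -sqr_u.
have : 2 < U by rewrite -(ltr_pXn2r (n := 2))// ?nnegrE ?ltW// sqr_u -natrX.
move=> u2; have : 0 < U * (U - 2) * (U + 1) ^+ 2 by rewrite !mulr_gt0 ?exprn_gt0// ?subr_gt0// addr_gt0.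
by lra.
Qed.

Let i_def := @sqr_iC R.

Lemma trig_conj (al be ga : R[i]) j :
  (trig_triple p A al be ga j)^*%C = trig_triple p A al^*%C be^*%C ga^*%C j.
Proof.
by rewrite !ffunE !(rmorphD, rmorphM); congr (_ + _ * _ + _ * _); exact: conjc_real.
Qed.

Lemma conjcDi (x y : R) : (x +i* y)^* = x%:C - 'i * y%:C.
Proof. by rewrite /= complexDi rmorphN mulrN. Qed.

Lemma explicit_sol (al be ga al' be' ga' : R[i]) :
  fourier_system p%:C (1 + J) (1 + Jb)
    al ((be + 'i * ga) / 2 / rho) ((be - 'i * ga) / 2 * rho)
    al' ((be' + 'i * ga') / 2 / rho) ((be' - 'i * ga') / 2 * rho) ->
  [/\ S (trig_triple p A al be ga),
      tinv (trig_triple p A al be ga) = trig_triple p A al' be' ga' &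
      mean_prod (trig_triple p A al be ga) = al * al'].
Proof.
move=> /fourier_solution; rewrite -!trig_synth => -[Ss si]; split=> //.
by rewrite /mean_prod si !trig_synth !mean_synth.
Qed.

Lemma conj_unimodular (al be ga : R[i]) : S (trig_triple p A al be ga) ->
  tinv (trig_triple p A al be ga) = trig_triple p A al^*%C be^*%C ga^*%C ->
  unimodular (trig_triple p A al be ga).
Proof.
move=> [s0 _] si; apply: unimodular_conj => j.
by rewrite trig_conj -si [tinv _ _]ffunE mulfV.
Qed.

(** In [explicit_quadratic] the coefficients of the inverse triple are here the complex conjugates,
    whence unimodularity. *)
Lemma sol1P : [/\ S (sol1 p A B), unimodular (sol1 p A B) &
  mean_prod (sol1 p A B) = ((p - A) / N)%:C].
Proof.
have uC : U%:C != 0 by rewrite fmorph_eq0 gt_eqF// u_gt0.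
have NC : N%:C != 0 by rewrite fmorph_eq0 gt_eqF// N_gt0.
have u2 : U%:C ^+ 2 = p%:C by rewrite -rmorphXn /= sqr_u.
have r2C : (Num.sqrt (p - 4))%:C ^+ 2 = U%:C ^+ 2 - 4.
  rewrite u2 -rmorphXn /= sqr_sqrtr ?subr_ge0 ?ltW//.
  by rewrite rmorphB rmorph_nat.
have t2C : (3 * Num.sqrt 3 * B)%:C ^+ 2 = 4 * U%:C ^+ 2 - A%:C ^+ 2.
  by rewrite u2 (sqrAC pAB); ring: (@sqr_sqrt3C R).
have h : (U%:C ^+ 2) ^+ 2 - 3 * U%:C ^+ 2 - A%:C != 0.
  by rewrite u2 (_ : _ - A%:C = N%:C) // /N; ring.
have hp : p%:C ^+ 2 - 3 * p%:C - A%:C != 0 by rewrite -u2.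
have uE : Num.sqrt p = U by [].
have := @explicit_quadratic _ _ i_def two_neq0 rho (alpha1 p A B) (beta1 p A B) (gamma1 p A B)
  (alpha1 p A B)^*%C (beta1 p A B)^*%C (gamma1 p A B)^*%C U%:C (Num.sqrt (p - 4))%:C
  A%:C (3 * Num.sqrt 3 * B)%:C uC h rho_neq0 rho_cube r2C t2C.
case.
- by rewrite /alpha1 complexDi uE u2; field; exact: hp.
- by rewrite /beta1 complexDi uE u2; field; exact: hp.
- by rewrite /gamma1 complexDi uE u2; field; exact: hp.
- by rewrite /alpha1 conjcDi uE u2; field; exact: hp.
- by rewrite /beta1 conjcDi uE u2; field; exact: hp.
- by rewrite /gamma1 conjcDi uE u2; field; exact: hp.
rewrite u2 => /explicit_sol[Ss si ->] mp.
split=> //; first exact: conj_unimodular.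
by rewrite mp /N; field; exact: hp.
Qed.

Let r1C : r1%:C ^+ 2 = (U%:C + V%:C) ^+ 2 - 16.
Proof. by rewrite -rmorphXn /= sqr_r1; ring. Qed.

Let r2C : r2%:C ^+ 2 = 16 - (U%:C - V%:C) ^+ 2.
Proof. by rewrite -rmorphXn /= sqr_r2; ring. Qed.

Let r1r2C : r1%:C * r2%:C = 12 * (Num.sqrt 3)%:C * B%:C.
Proof. by rewrite -rmorphM /= r1_r2; ring. Qed.

Let AC : A%:C = (V%:C ^+ 2 - U%:C ^+ 2 - 16) / 4.
Proof. by rewrite -!rmorphXn /= sqr_v sqr_u; field. Qed.

Let uC : U%:C != 0. Proof. by rewrite fmorph_eq0 gt_eqF// u_gt0. Qed.

Let u2 : U%:C ^+ 2 = p%:C. Proof. by rewrite -rmorphXn /= sqr_u. Qed.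

(* The substitution [v -> - v], [r1 -> - i r2], [r2 -> i r1] in
   [explicit_radical] turns [sol3] into [sol2]. *)
Lemma sol2P : [/\ S (sol2 p A B), unimodular (sol2 p A B) &
  mean_prod (sol2 p A B) = (2 / (p + U * V + 2))%:C].
Proof.
have D0 : p%:C + U%:C * V%:C + 2 != 0.
  rewrite (_ : _ + 2 = (p + U * V + 2)%:C); last by ring.
  by rewrite fmorph_eq0 gt_eqF// !addr_gt0 ?mulr_gt0 ?u_gt0 ?v_gt0 ?(lt_trans _ p_gt4).
have DE : p%:C + U%:C * V%:C + 2 = U%:C ^+ 2 - U%:C * - V%:C + 2 by rewrite u2; ring.
have h : U%:C ^+ 2 - U%:C * - V%:C + 2 != 0 by rewrite -DE.
have AE : ((- V%:C) ^+ 2 - U%:C ^+ 2 - 16) / 4 = A%:C by rewrite AC sqrrN.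
have rr : - 'i * r2%:C * ('i * r1%:C) / 4 = (3 * Num.sqrt 3 * B)%:C.
  by field: i_def r1r2C.
have := @explicit_radical _ _ i_def two_neq0 rho (alpha2 p A) (beta2 p A) (gamma2 p A B)
  (alpha2 p A)^*%C (beta2 p A)^*%C (gamma2 p A B)^*%C U%:C (- V%:C) (- 'i * r2%:C)
  ('i * r1%:C) uC h rho_neq0.
rewrite AE rr -DE u2 rho_cube => /(_ erefl); case.
- by ring: i_def r2C.
- by ring: i_def r1C.
- by rewrite /alpha2 complexDi !sqr_u /r2; field; exact: D0.
- by rewrite /beta2 complexDi !sqr_u /r2; field; exact: D0.
- by rewrite /gamma2 complexDi !sqr_u /r1; field; exact: D0.
- by rewrite /alpha2 conjcDi !sqr_u /r2; field; exact: D0.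
- by rewrite /beta2 conjcDi !sqr_u /r2; field; exact: D0.
- by rewrite /gamma2 conjcDi !sqr_u /r1; field; exact: D0.
move=> /explicit_sol[Ss si ->] mp.
split=> //; first exact: conj_unimodular.
by rewrite mp; field; exact: D0.
Qed.

Hypothesis D3_neq0 : p - U * V + 2 != 0.

Lemma sol3P : [/\ S (sol3 p A B), real_triple (sol3 p A B) &
  mean_prod (sol3 p A B) = (2 / (p - U * V + 2))%:C].
Proof.
have D0 : p%:C - U%:C * V%:C + 2 != 0.
  rewrite (_ : _ + 2 = (p - U * V + 2)%:C); last by ring.
  by rewrite fmorph_eq0.
have h : U%:C ^+ 2 - U%:C * V%:C + 2 != 0 by rewrite u2.
have rr : r1%:C * r2%:C / 4 = (3 * Num.sqrt 3 * B)%:C by field: r1r2C.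
have := @explicit_radical _ _ i_def two_neq0 rho (alpha3 p A)%:C (beta3 p A)%:C
  (gamma3 p A B)%:C _ _ _ U%:C V%:C r1%:C r2%:C uC h rho_neq0.
rewrite -AC rr u2 rho_cube => /(_ _ _ _ erefl r1C r2C).
have e1 : (alpha3 p A)%:C = (- (1 / 2) * (p%:C + U%:C * V%:C - 4) - U%:C / 2 * r1%:C) / (p%:C - U%:C * V%:C + 2).
  by rewrite /alpha3 !sqr_u /r1; field; exact: D0.
have e2 : (beta3 p A)%:C = ((A%:C + 2) * U%:C - 1 / 4 * (p%:C - U%:C * V%:C + 4) * r1%:C) / (p%:C - U%:C * V%:C + 2).
  by rewrite /beta3 !sqr_u /r1; field; exact: D0.
have e3 : (gamma3 p A B)%:C = (U%:C * (3 * Num.sqrt 3 * B)%:C + 1 / 4 * (p%:C + U%:C * V%:C - 4) * r2%:C) / (p%:C - U%:C * V%:C + 2).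
  by rewrite /gamma3 !sqr_u /r2; field; exact: D0.
(* Each [erefl] takes a coefficient of the inverse triple straight from [explicit_radical]. *)
case/(_ _ _ _ e1 e2 e3 erefl erefl erefl) => /explicit_sol[Ss si ->] mp.
split=> //; last by rewrite mp; field; exact: D0.
by move=> j; rewrite ffunE !rpredD ?rpredM//; rewrite complex_real.
Qed.

End Solutions.

(** * Counting *)

Section Main.
Context {R : realType}.
Variables p A B : R.
Hypothesis p_gt4 : 4 < p.
Hypothesis pAB : 4 * p = A ^+ 2 + 27 * B ^+ 2.
Hypothesis B_gt0 : 0 < B.
(** Two conditions supplied by arithmetic: the first gives mu3 <> 1, the second D3 <> 0. *)
Hypothesis A_neqN4 : A != - 4.
Hypothesis A3p_neq1 : (A + 3) * p != 1.

Local Notation S := (solutions p A B).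
Local Notation U := (u p).
Local Notation V := (v p A).
Implicit Types c : triple R.

Let N := p ^+ 2 - 3 * p - A.
Let D2 := p + U * V + 2.
Let D3 := p - U * V + 2.
Let mu1 := (p - A) / N.
Let mu2 := 2 / D2.
Let mu3 := 2 / D3.

Let U0 : 0 < U := u_gt0 p_gt4.
Let V0 : 0 < V := v_gt0 p_gt4 pAB B_gt0.
Let U2 : U ^+ 2 = p := sqr_u p_gt4.
Let V2 : V ^+ 2 = p + 4 * A + 16 := sqr_v p_gt4 pAB B_gt0.
Let N0 : N != 0. Proof. by rewrite gt_eqF// (N_gt0 p_gt4 pAB B_gt0). Qed.
Let p0 : 0 < p. Proof. exact: lt_trans p_gt4. Qed.

Let D2_neq0 : D2 != 0.
Proof. by rewrite gt_eqF// !addr_gt0// mulr_gt0. Qed.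

Let D2D3 : D2 * D3 = 4 * (1 - 3 * p - A * p).
Proof.
apply: (@etrans _ _ ((p + 2) ^+ 2 - U ^+ 2 * V ^+ 2)); first by rewrite /D2 /D3; ring.
by rewrite V2 U2; ring.
Qed.

Lemma D3_neq0 : p - U * V + 2 != 0.
Proof.
apply: contra_neq A3p_neq1 => D30; have := D2D3.
by rewrite /D3 D30 mulr0; lra.
Qed.

(* The excluded equality would force [4 p = A ^ 2] or [2 p = A + 4]. *)
Lemma mu1_neq (s : R) : s ^+ 2 = p * (p + 4 * A + 16) -> p + s + 2 != 0 ->
  mu1 != 2 / (p + s + 2).
Proof.
move=> s2 D0; apply/eqP; rewrite /mu1 => /eqP; rewrite eqr_div// => /eqP e.
have sE : s * (p - A) = p * (p + A - 8).
  by apply: (eqr_by e); rewrite /N; ring.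
have : p * (4 * ((4 * p - A ^+ 2) * (2 * p - A - 4))) = 0.
  have : s ^+ 2 * (p - A) ^+ 2 = (p * (p + A - 8)) ^+ 2 by rewrite -sE; ring.
  by rewrite s2 => h; apply: (eqr_by h); ring.
have A2 := sqrA_lt pAB B_gt0.
have h1 : 0 < 4 * p - A ^+ 2 by rewrite subr_gt0.
have h2 : 0 < 2 * p - A - 4.
  (* Otherwise A >= 2 p - 4 > 0, so (2 p - 4)^2 < 4 p, that is (p - 1) (p - 4) < 0. *)
  rewrite ltNge; apply/negP => h; move: p_gt4 => p4.
  have : (2 * p - 4) ^+ 2 <= A ^+ 2 by rewrite ler_pXn2r ?nnegrE//; lra.
  have : 0 < (p - 1) * (p - 4) by rewrite mulr_gt0 ?subr_gt0//; lra.
  lra.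
by apply/eqP; rewrite gt_eqF// !mulr_gt0.
Qed.

(** [mu1_neq] is applied with s = U V and s = - U V, the sign that separates mu2 from mu3. *)
Lemma mu_neq : [/\ mu1 != mu2, mu1 != mu3 & mu2 != mu3].
Proof.
have uv2 : (U * V) ^+ 2 = p * (p + 4 * A + 16) by rewrite exprMn U2 V2.
split.
- exact: mu1_neq.
- by apply: mu1_neq; [rewrite sqrrN | exact: D3_neq0].
- rewrite /mu2 /mu3 eqr_div ?D3_neq0//.
  rewrite (inj_eq (mulfI _)) ?pnatr_eq0// /D2 /D3 -subr_eq0.
  rewrite (_ : _ - _ = - (2 * (U * V))); last by ring.
  by rewrite oppr_eq0 !mulf_neq0// ?pnatr_eq0// gt_eqF.
Qed.

(** The value 1 belongs to the epsilon-solutions. It is excluded by N - (p - A) = p (p - 4), by D2 >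
    2, and because D3 = 2 would give U = V, so A = - 4. *)
Lemma mu_neq1 : [/\ mu1 != 1, mu2 != 1 & mu3 != 1].
Proof.
have div1 (x y : R) : y != 0 -> x != y -> x / y != 1.
  by move=> y0; apply: contra_neq => h; rewrite -[x](divfK y0) h mul1r.
split; apply: div1 => //; rewrite ?D3_neq0//.
- rewrite -subr_eq0 (_ : _ - _ = - (p * (p - 4))); last by rewrite /N; ring.
  by rewrite oppr_eq0 mulf_neq0// ?gt_eqF// subr_gt0.
- by rewrite lt_eqF// /D2 ltrDr addr_gt0// mulr_gt0.
- apply: contra_neq A_neqN4 => /esym D32.
  have : U * (U - V) = 0 by rewrite mulrBr -expr2 U2; move: D32; rewrite /D3; lra.
  move/eqP; rewrite mulf_eq0 gt_eqF//= subr_eq0 => /eqP UV.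
  by move: V2; rewrite -UV U2; lra.
Qed.

Local Notation c1 := (sol1 p A B).
Local Notation c2 := (sol2 p A B).
Local Notation c3 := (sol3 p A B).
Local Notation eps := [set eps_plus p; eps_minus p].

Let ok1 := sol1P p_gt4 pAB B_gt0.
Let ok2 := sol2P p_gt4 pAB B_gt0.
Let ok3 := sol3P p_gt4 pAB B_gt0 D3_neq0.

Lemma sol_nonconst : [/\ nonconst c1, nonconst c2 & nonconst c3].
Proof.
case: ok1 => S1 _ e1; case: ok2 => S2 _ e2; case: ok3 => S3 _ e3.
have [n1 n2 n3] := mu_neq1.
by split; apply: (mean_prod_nonconst p_gt4 pAB B_gt0) => //;
  rewrite ?e1 ?e2 ?e3 fmorph_eq1.
Qed.

(** The cubic leaves mu1, mu2, mu3 as values of [mean_prod]; these are attained by c1, c2, c3, and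
    [transforms_mean] identifies the orbit. *)
Lemma solutions_setD_eps :
  S `\` eps = transforms c1 `|` transforms c2 `|` transforms c3.
Proof.
have epsP := eps_eqP p_gt4 pAB B_gt0.
have [nc1 nc2 nc3] := sol_nonconst.
case: ok1 => S1 _ e1; case: ok2 => S2 _ e2; case: ok3 => S3 _ e3.
apply/seteqP; split=> c.
  move=> [Sc ceps]; have nc : nonconst c.
    by case: (boolP (nonconst c)) => // nc; case: ceps; apply/epsP.
  have cover := transforms_mean p_gt4 pAB B_gt0 Sc.
  have := mean_prod_cubic p_gt4 pAB B_gt0 Sc nc.
  (* The roots are 2 / D2 and 2 / D3: the leading coefficient is D2 D3 / 4, and D2 + D3 = 2 (p +
     2). *)
  have -> : ((1 - 3 * p - A * p)%:C * mean_prod c ^+ 2 - (p + 2)%:C * mean_prod c + 1 =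
      (D2%:C / 2 * mean_prod c - 1) * (D3%:C / 2 * mean_prod c - 1))%C.
    rewrite (_ : 1 - _ - _ = D2 * D3 / 4); last by rewrite D2D3; field.
    by rewrite /D2 /D3; field.
  have root (x y z : R[i]) : y != 0 -> y * z - x = 0 -> z = x / y.
    by move=> y0 /eqP; rewrite subr_eq0 => /eqP <-; rewrite mulrC mulKf.
  have rootD (D : R) : D != 0 -> (D%:C / 2 * mean_prod c - 1)%C = 0 -> mean_prod c = (2 / D)%:C%C.
    move=> D0 h; have DC : (D%:C)%C != 0 by rewrite fmorph_eq0.
    by rewrite (root _ _ _ _ h) ?mulf_neq0 ?invr_eq0 ?pnatr_eq0//; field.
  move=> /eqP; rewrite !mulf_eq0 => /or3P[]/eqP h.
  - left; left; apply: cover => //; rewrite e1 (root _ _ _ _ h) ?fmorph_eq0//.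
    by rewrite -fmorph_div.
  - by left; right; apply: cover => //; rewrite e2 (rootD D2).
  - by right; apply: cover => //; rewrite e3 (rootD D3)// D3_neq0.
move=> h.
have [Sc nc] : S c /\ nonconst c.
  by case: h => [[]|] h; split; (apply: transforms_solution h || apply: transforms_nonconst h).
split=> //= ceps; have [_] : S c /\ ~~ nonconst c by apply/epsP.
by rewrite nc.
Qed.

Lemma eps_neq : eps_plus p != eps_minus p.
Proof.
apply/eqP => /ffunP /(_ 0); rewrite !ffunE => /(@complexI R).
have : 0 < Num.sqrt (p * (p - 4)) by rewrite sqrtr_gt0 mulr_gt0// subr_gt0.
by move=> h /(congr1 (fun x => x * 2)); rewrite !mulfVK ?pnatr_eq0//; lra.
Qed.

Lemma eps_sol : S (eps_plus p) /\ S (eps_minus p).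
Proof.
have epsP := eps_eqP p_gt4 pAB B_gt0.
by split; [have [] := (epsP (eps_plus p)).2 (or_introl erefl)
          |have [] := (epsP (eps_minus p)).2 (or_intror erefl)].
Qed.

Lemma eps_real : real_triple (eps_plus p) /\ real_triple (eps_minus p).
Proof. by split=> j; rewrite ffunE complex_real. Qed.

Lemma card_eps : eps #= `I_2.
Proof.
apply: (@card_setU_disjoint _ _ _ 1 1); rewrite ?card_set1//.
by move=> _ -> /eqP; rewrite (negbTE eps_neq).
Qed.

(** Orbits of size 6 with distinct values of mu are disjoint: 6 + 6 = 12, 12 + 6 = 18, and the
    epsilon-solutions add 2. *)
Lemma card_orbits : [/\ transforms c1 `|` transforms c2 #= `I_12,
   S `\` eps #= `I_18 & S #= `I_20].
Proof.
have [nc1 nc2 nc3] := sol_nonconst; have [n12 n13 n23] := mu_neq.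
have SD := solutions_setD_eps; have [Se1 Se2] := eps_sol.
case: ok1 => S1 _ e1; case: ok2 => S2 _ e2; case: ok3 => S3 _ e3.
have card c := @card_transforms _ _ _ _ p_gt4 pAB B_gt0 c.
have disj (c c' d : triple R) (x y : R) : x != y -> mean_prod c = x%:C%C -> mean_prod c' = y%:C%C ->
    transforms c d -> ~ transforms c' d.
  move=> xy cx cy /transforms_mean_prod + /transforms_mean_prod.
  by rewrite cx cy => -> /complexI /eqP; rewrite (negbTE xy).
have c12 : transforms c1 `|` transforms c2 #= `I_12.
  apply: (@card_setU_disjoint _ _ _ 6 6); rewrite ?card// => d.
  exact: (disj _ _ _ _ _ n12 e1 e2).
have c123 : S `\` eps #= `I_18.
  rewrite SD; apply: (@card_setU_disjoint _ _ _ 12 6); rewrite ?card// => d [].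
  - exact: (disj _ _ _ _ _ n13 e1 e3).
  - exact: (disj _ _ _ _ _ n23 e2 e3).
split=> //.
have -> : S = (S `\` eps) `|` eps.
  rewrite setDKU//; move=> _ [->|->]//.
apply: (@card_setU_disjoint _ _ _ 18 2) => //; first exact: card_eps.
by move=> d [].
Qed.

Lemma solutions_split : S = transforms c1 `|` transforms c2 `|` (transforms c3 `|` eps).
Proof.
rewrite setUA -solutions_setD_eps setDKU//.
by have [? ?] := eps_sol; move=> _ [->|->].
Qed.

Lemma unimodular_sub : transforms c1 `|` transforms c2 `<=` S `&` unimodular.
Proof.
case: ok1 => S1 u1 _; case: ok2 => S2 u2 _.
move=> c [] h; split;
  by [apply: transforms_solution h | apply: transforms_unimodular h].
Qed.

Lemma real_sub : transforms c3 `|` eps `<=` S `&` real_triple.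
Proof.
case: ok3 => S3 r3 _; have [Se1 Se2] := eps_sol; have [re1 re2] := eps_real.
move=> c [h|[->|->]]//; split;
  by [apply: transforms_solution h | apply: transforms_real h].
Qed.

(** The remaining solutions are real, and no solution is both real and unimodular. *)
Lemma unimodular_solutions : S `&` unimodular = transforms c1 `|` transforms c2.
Proof.
apply/seteqP; split; last exact: unimodular_sub.
move=> c [Sc uc]; move: (Sc); rewrite {1}solutions_split => -[//|/real_sub[_ rc]].
by have := real_not_unimodular p_gt4 pAB B_gt0 Sc rc uc.
Qed.

Lemma real_solutions : S `&` real_triple = transforms c3 `|` eps.
Proof.
apply/seteqP; split; last exact: real_sub.
move=> c [Sc rc]; move: (Sc); rewrite {1}solutions_split => -[/unimodular_sub[_ uc]|//].
by have := real_not_unimodular p_gt4 pAB B_gt0 Sc rc uc.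
Qed.

Lemma card_real : transforms c3 `|` eps #= `I_8.
Proof.
case: ok3 => S3 _ _; have [_ _ nc3] := sol_nonconst.
apply: (@card_setU_disjoint _ _ _ 6 2); last 1 first.
- move=> c h ec; have : (S `\` eps) c by rewrite solutions_setD_eps; right.
  by case.
- exact: (card_transforms p_gt4 pAB B_gt0).
- exact: card_eps.
Qed.
End Main.

Theorem theorem4p1 (R : realType) (p : nat) (A B : int)
    (p_prime : prime p) (p_mod6 : p = 1 %[mod 6])
    (pAB : 4 * p%:Z = A ^+ 2 + 27 * B ^+ 2)
    (A_mod3 : (A = 1 %[mod 3])%Z) (B_gt0 : 0 < B) :
  let pR : R := p%:R in
  let AR : R := A%:~R in
  let BR : R := B%:~R in
  let S := solutions pR AR BR in
  let eps1 := eps_plus pR in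
  let eps2 := eps_minus pR in
  let c1 := sol1 pR AR BR in
  let c2 := sol2 pR AR BR in
  let c3 := sol3 pR AR BR in
  [/\ S #= `I_20,
      [/\ eps1 != eps2, S eps1 & S eps2],
      [/\ S c1, S c2, S c3,
          S `\` [set eps1; eps2] #= `I_18
        & S `\` [set eps1; eps2] =
          transforms c1 `|` transforms c2 `|` transforms c3],
      [/\ unimodular c1, unimodular c2,
          real_triple eps1, real_triple eps2 & real_triple c3]
    & S `&` unimodular #= `I_12 /\ S `&` real_triple #= `I_8].
Proof.
move=> pR AR BR S eps1 eps2 c1 c2 c3.
(* A prime congruent to 1 modulo 6 is at least 7. *)
have p_gt4 : (4 < p)%N by have := prime_gt1 p_prime; lia.
have h1 : 4 < pR by rewrite (ltr_nat _ 4).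
have h2 : 4 * pR = AR ^+ 2 + 27 * BR ^+ 2.
  by have := congr1 (fun z : int => z%:~R : R) pAB; rewrite /pR /AR /BR => h; apply: (eqr_by h); ring.
have h3 : 0 < BR by rewrite ltr0z.
(* - 4 is congruent to 2 modulo 3. *)
have h4 : AR != - 4 by rewrite (_ : - 4 = (- 4)%:~R) ?eqr_int; [lia|ring].
(* An integer multiple of p equal to 1 would force p = 1. *)
have h5 : (AR + 3) * pR != 1.
  rewrite (_ : _ * _ = ((A + 3) * p%:Z)%:~R); last by rewrite /AR /pR; ring.
  rewrite (_ : 1 = 1%:~R)// eqr_int.
  apply/eqP => /(congr1 absz) /eqP; rewrite abszM muln_eq1 => /andP[_].
  by rewrite absz_nat gtn_eqF// (ltn_trans _ p_gt4).
have [s1 u1 _] := sol1P h1 h2 h3; have [s2 u2 _] := sol2P h1 h2 h3.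
have [s3 r3 _] := sol3P h1 h2 h3 (D3_neq0 h1 h2 h3 h5).
have [se1 se2] := eps_sol h1 h2 h3; have [re1 re2] := eps_real pR.
have [k12 k18 k20] := card_orbits h1 h2 h3 h4 h5.
split=> //.
- by split=> //; exact: eps_neq.
- by split=> //; exact: solutions_setD_eps.
- by rewrite unimodular_solutions ?real_solutions//; split=> //; exact: card_real.
Qed.
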